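(* Let $k>0$ and $\beta>0$ satisfy $$\left(1+\frac{4}{\pi^2}\right)\beta<k,\qquad \eta(\beta,k)<\min\{1,k\},$$ where $\eta(\beta,k)=\max\left\{\beta,\ \frac{4\beta}{\pi^2k-(\pi^2+4)\beta}\right\}$, and let the well-posedness assumption (WP) stated in the context be valid. Then for all $H^*>0$ and $\gamma>0$, for any $\varepsilon>0$ such that $\eta(\beta,k)<\varepsilon<\min\{1,k\}$, for all $\alpha>0$ satisfying $$\frac{\varepsilon k}{2}\alpha^2-k\alpha+\frac{\varepsilon}{2}\le 0,$$ and for any initial conditions $(z^0,z^1)\in\mathcal{W}_0$ and $(\widehat z^0,\widehat z^1)\in\mathcal{W}_0$ such that the corresponding solution $(z,\widehat z)$ of the closed-loop system (CL) of the context satisfies $H(z(0))\ne0$ and $H(z(t))\ne0$ for all $t\ge0$, one has $$H(z(t))\to H^*\quad\text{as } t\to\infty.$$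
   Context: Fix parameters $k>0$, $\beta>0$, and a continuous function $\psi\colon\mathbb{R}\to\mathbb{R}$ with $\psi(0)=0$ and $\psi(s)s>0$ for all $s\ne0$. The energy (Hamiltonian) of a function $z(t,x)$ at time $t$ is $$H(z(t))=\int_0^1\left(\frac{z_t(t,x)^2}{2}+k\frac{z_x(t,x)^2}{2}+\beta(1-\cos z(t,x))\right)dx .$$ For a desired energy level $H^*$, an observer gain $\alpha>0$ and a control gain $\gamma>0$, the closed-loop system (CL) for the pair $(z,\widehat z)$ is \begin{gather*} z_{tt}(t,x)-kz_{xx}(t,x)+\beta\sin z(t,x)=0,\quad t\ge0,\ x\in(0,1),\\ \widehat z_{tt}(t,x)-k\widehat z_{xx}(t,x)+\beta\sin\widehat z(t,x)=0,\quad t\ge0,\ x\in(0,1),\\ z(0,x)=z^0(x),\quad z_t(0,x)=z^1(x),\quad \widehat z(0,x)=\widehat z^0(x),\quad \widehat z_t(0,x)=\widehat z^1(x),\quad x\in(0,1),\\ z(t,0)=0,\quad z_x(t,1)=u(t),\quad t\ge0,\\ \widehat z(t,0)=0,\quad \widehat z_x(t,1)=u(t)+\alpha\big(z_t(t,1)-\widehat z_t(t,1)\big),\quad t\ge0,\\ u(t)=-\gamma\,\psi\big(H(\widehat z(t))-H^*\big)\,z_t(t,1),\quad t\ge0 . \end{gather*} Well-posedness assumption (WP): for all $\alpha>0$, $\gamma>0$ and $H^*>0$ there is a nonempty set of initial data $\mathcal{W}_0\subseteq W^2_2(0,1)\times W^1_2(0,1)$ ($W^m_p(0,1)$ being Sobolev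 spaces; $\mathcal{W}_0$ may depend on the parameters of the system) such that for any $(z^0,z^1)\in\mathcal{W}_0$ and $(\widehat z^0,\widehat z^1)\in\mathcal{W}_0$ there exists a unique regular solution $(z,\widehat z)$ of (CL) such that (1) it is defined on a maximal interval of existence $[0,T_{\max})$, $0<T_{\max}\le+\infty$, and if $T_{\max}<+\infty$, then $H(z(t))+H(\widehat z(t))\to+\infty$ as $t\to T_{\max}$; (2) the functions $t\mapsto H(z(t))$ and $t\mapsto H(\widehat z(t))$ are locally absolutely continuous. Here ''regular'' means that $$z,\widehat z\in C\big([0,T_{\max});W^2_2(0,1)\big)\cap C^1\big([0,T_{\max});W^1_2(0,1)\big)\cap C^2\big([0,T_{\max});L_2(0,1)\big).$$ Under the hypotheses of the claim on $k,\beta,\varepsilon,\alpha,\gamma$ and the initial data one has $T_{\max}=+\infty$, so that $H(z(t))$ is defined for all $t\ge0$. *)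

(* Defs.v *)
From mathcomp Require Import all_boot all_order all_algebra.
From mathcomp Require Import all_classical all_reals all_analysis.
Set Implicit Arguments.
Unset Strict Implicit.
Unset Printing Implicit Defensive.
Import Order.TTheory GRing.Theory Num.Theory.
Import numFieldNormedType.Exports.
Local Open Scope classical_set_scope.
Local Open Scope ring_scope.

(* Elements of L_2(0,1) and of the Sobolev spaces are represented by functions
   R -> R that matter only almost everywhere on (0,1).  A function z(t,x) is
   the curve t |-> z t of such representatives. *)

Section Sobolev.
Context {R : realType}.
Implicit Types (u v c phi : R -> R) (z : R -> R -> R) (T : \bar R).

Local Notation mu := (@lebesgue_measure R).

Definition I01 : set R := [set` `]0, 1[].

Definition ae_eq01 u v : Prop := u = v %[ae mu in I01].

Definition L2 u : Prop := (u \_ I01) \in Lfun mu 2%:E.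

Definition L2norm u : R := fine ('N[mu]_2%:E [EFin \o (u \_ I01)])%E.

(* Test functions are C^1 with compact support in (0,1), as in the definition
   of W^{1,p} of an interval in Brezis, "Functional Analysis, Sobolev Spaces
   and Partial Differential Equations", Section 8.2; smooth test functions
   define the same spaces. *)
Definition test_function phi : Prop :=
  [/\ forall x, derivable phi x 1,
      continuous (derive1 phi) &
      exists a b, [/\ 0 < a, b < 1 & forall x, x \notin `[a, b] -> phi x = 0]].

Definition is_weak_deriv u v : Prop :=
  forall phi, test_function phi ->
    \int[mu]_(x in I01) (u x * derive1 phi x) =
    - \int[mu]_(x in I01) (v x * phi x).

(* W m is W^m_2(0,1), and W 0 is L_2(0,1). *)
Fixpoint W (m : nat) u : Prop :=
  L2 u /\
  match m with
  | 0%N => True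
  | m'.+1 => exists2 v, is_weak_deriv u v & W m' v
  end.

(* A representative of the weak derivative; unique up to ae_eq01 for u in
   W 1, and the junk value 0 when there is none. *)
Definition wderiv u : R -> R :=
  xget (cst 0) [set v | L2 v /\ is_weak_deriv u v].

Definition Wnorm (m : nat) u : R :=
  Num.sqrt (\sum_(i < m.+1) L2norm (iter i wderiv u) ^+ 2).

(* Boundary values of u in W 1 are those of its continuous representative. *)
Definition cont_repr u : R -> R :=
  xget (cst 0)
    [set c : R -> R | {within `[0 : R, 1], continuous c} /\ ae_eq01 c u].

Definition trace u (a : R) : R := cont_repr u a.

(* Time ranges over [0, +oo), so that the derivative at 0 is one-sided; for
   t in [0, T) the filters below are those of [0, T) at t. *)
Definition is_tderiv (m : nat) z (t : R) v : Prop :=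
  Wnorm m (fun x => (z s x - z t x) / (s - t) - v x)
    @[s --> within [set s | 0 <= s /\ s != t] (nbhs t)] --> 0.

Definition curve_continuous (m : nat) T z : Prop :=
  forall t, 0 <= t -> (t%:E < T)%E ->
    W m (z t) /\
    Wnorm m (z s \- z t) @[s --> within [set s | 0 <= s] (nbhs t)] --> 0.

(* C^j([0, T); W^m_2(0,1)) *)
Fixpoint curve_C (j m : nat) T z : Prop :=
  curve_continuous m T z /\
  match j with
  | 0%N => True
  | j'.+1 => exists2 w : R -> R -> R,
      (forall t, 0 <= t -> (t%:E < T)%E -> is_tderiv m z t (w t)) &
      curve_C j' m T w
  end.

(* z_t, as an L_2(0,1)-valued derivative: a derivative in the norm of W^1_2
   is also one in L_2, hence is the same function up to ae_eq01. *)
Definition tderiv z (t : R) : R -> R :=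
  xget (cst 0) [set v | L2 v /\ is_tderiv 0 z t v].

Definition regular T z : Prop :=
  [/\ curve_C 0 2 T z, curve_C 1 1 T z & curve_C 2 0 T z].

Definition energy (k beta : R) z (t : R) : R :=
  \int[mu]_(x in I01)
    ((tderiv z t x) ^+ 2 / 2 + k * ((wderiv (z t) x) ^+ 2 / 2)
     + beta * (1 - cos (z t x))).

Definition absolutely_continuous (a b : R) (f : R -> R) : Prop :=
  forall e, 0 < e -> exists2 d, 0 < d &
    forall n (I : 'I_n -> R * R),
      (forall i, [/\ a <= (I i).1, (I i).1 <= (I i).2 & (I i).2 <= b]) ->
      (forall i j, i != j -> (I i).2 <= (I j).1 \/ (I j).2 <= (I i).1) ->
      \sum_(i < n) ((I i).2 - (I i).1) < d ->
      \sum_(i < n) `|f (I i).2 - f (I i).1| < e.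

Definition locally_absolutely_continuous T (f : R -> R) : Prop :=
  forall b, 0 <= b -> (b%:E < T)%E -> absolutely_continuous 0 b f.

End Sobolev.

Section ClosedLoop.
Context {R : realType}.
Variables (k beta : R) (psi : R -> R).
Implicit Types (z zh : R -> R -> R) (T : \bar R).

Definition sine_Gordon z (t : R) : Prop :=
  ae_eq01
    (fun x => tderiv (tderiv z) t x - k * wderiv (wderiv (z t)) x
              + beta * sin (z t x))
    (cst 0).

Section Gains.
Variables (alpha gamma Hstar : R).

Definition control z zh (t : R) : R :=
  - gamma * psi (energy k beta zh t - Hstar) * trace (tderiv z t) 1.

Definition closed_loop_at z zh (t : R) : Prop :=
  [/\ sine_Gordon z t, sine_Gordon zh t,
      trace (z t) 0 = 0 /\ trace (wderiv (z t)) 1 = control z zh t &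
      trace (zh t) 0 = 0 /\
      trace (wderiv (zh t)) 1 =
        control z zh t
        + alpha * (trace (tderiv z t) 1 - trace (tderiv zh t) 1)].

(* (z, zh) is a regular solution of the closed-loop system on [0, T). *)
Definition regular_solution (z0 z1 zh0 zh1 : R -> R) T z zh : Prop :=
  [/\ (0 < T)%E,
      regular T z /\ regular T zh,
      ae_eq01 (z 0) z0 /\ ae_eq01 (tderiv z 0) z1,
      ae_eq01 (zh 0) zh0 /\ ae_eq01 (tderiv zh 0) zh1 &
      forall t, 0 <= t -> (t%:E < T)%E -> closed_loop_at z zh t].

Definition agree_before T z zh z' zh' : Prop :=
  forall t, 0 <= t -> (t%:E < T)%E ->
    ae_eq01 (z t) (z' t) /\ ae_eq01 (zh t) (zh' t).

(* [0, T) is the maximal interval of existence of the regular solution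
   (z, zh): it has no regular extension to a longer interval. *)
Definition maximal_solution (z0 z1 zh0 zh1 : R -> R) T z zh : Prop :=
  regular_solution z0 z1 zh0 zh1 T z zh /\
  forall T' z' zh', regular_solution z0 z1 zh0 zh1 T' z' zh' ->
    (T <= T')%E -> agree_before T z zh z' zh' -> T' = T.

Definition uniquely_solvable (z0 z1 zh0 zh1 : R -> R) : Prop :=
  exists T z zh,
    [/\ maximal_solution z0 z1 zh0 zh1 T z zh,
        forall T' z' zh', regular_solution z0 z1 zh0 zh1 T' z' zh' ->
          agree_before (Order.min T T') z zh z' zh',
        forall Tmax : R, T = Tmax%:E ->
          energy k beta z t + energy k beta zh t @[t --> Tmax^'-] --> +oo &
        locally_absolutely_continuous T (energy k beta z) /\
        locally_absolutely_continuous T (energy k beta zh)].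

End Gains.

(* W0 alpha gamma Hstar is the set of admissible initial data (z^0, z^1). *)
Definition well_posed
    (W0 : R -> R -> R -> set ((R -> R) * (R -> R))) : Prop :=
  forall alpha gamma Hstar, 0 < alpha -> 0 < gamma -> 0 < Hstar ->
  [/\ W0 alpha gamma Hstar !=set0,
      forall z0 z1 : R -> R, W0 alpha gamma Hstar (z0, z1) -> W 2 z0 /\ W 1 z1 &
      forall z0 z1 zh0 zh1 : R -> R,
        W0 alpha gamma Hstar (z0, z1) -> W0 alpha gamma Hstar (zh0, zh1) ->
        uniquely_solvable alpha gamma Hstar z0 z1 zh0 zh1].

End ClosedLoop.

Definition eta {R : realType} (beta k : R) : R :=
  Num.max beta (4 * beta / (pi ^+ 2 * k - (pi ^+ 2 + 4) * beta)).

(* Main.v *)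
Require Import Defs.
From mathcomp Require Import all_boot all_order all_algebra.
From mathcomp Require Import all_classical all_reals all_analysis.
From mathcomp Require Import measurable_realfun ring lra.
Set Implicit Arguments.
Unset Strict Implicit.
Unset Printing Implicit Defensive.
Import Order.TTheory GRing.Theory Num.Theory.
Import numFieldNormedType.Exports.
Local Open Scope classical_set_scope.
Local Open Scope ring_scope.

(** The proof combines an observer argument for the error [e = z - zh] with an
    energy argument for the plant [z].  Both rest on the multiplier [x * y_x].

    The error solves a wave equation whose forcing is bounded by [beta * |e|],
    with the damping [e_x = - alpha * e_t] at the right end.  The functional
    [V = (|e_t|^2 + k |e_x|^2) / 2 + eps * <x e_x, e_t>] ([lyapunov]) satisfies
    [V' <= - kappa * V] ([lyapunov_decay]): the condition on [alpha] makes the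
    boundary terms nonpositive, and [eta beta k < eps] is exactly what lets
    the multiplier absorb the forcing by means of the Wirtinger inequality
    with its sharp constant ([wirtinger]).  Hence [V] tends to 0, and with it
    the gap between the energies of plant and observer, relative to these
    energies ([energy_gap]).

    The energy [H] of the plant satisfies
    [H' = - k gamma psi (Hh - Hstar) z_t(t, 1)^2], [Hh] being the energy of the
    observer.  When [H] is large, so is [Hh]; then [psi] is positive and [H]
    decreases.  So the energies stay bounded ([energies_bounded]), and a
    solution that is maximal cannot stop at a finite time.

    It remains to see that [H] tends to [Hstar].  Once the gap is small, [H]
    cannot leave a neighbourhood of [Hstar].  If it never entered, [psi]
    would keep its sign and stay away from 0, and [H], being positive, would
    stay away from 0 as well.  The multiplier [rho = <x z_x, z_t>] then
    satisfies [rho' <= C * z_t(t, 1)^2 - c1 * H] ([multiplier_observability]),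
    where the boundary term is a multiple of [H'] up to a bounded factor; so
    a suitable combination of [rho] and [H], which is bounded, would decrease
    at least linearly ([no_stagnation]).  No limit points of trajectories are
    needed.

    Most of the text gives meaning to the integrations by parts.  A function
    of W^1_2(0, 1) is almost everywhere equal to the primitive of its weak
    derivative ([weak_deriv_H1], by the lemma of du Bois-Reymond), a product
    of two primitives is a primitive ([prim_mul], by Fubini), and the
    difference quotients of a regular solution converge in L_2, which makes
    its quadratic functionals differentiable in time ([is_derive_ip]). *)

(** * Square-integrable functions on (0, 1) *)

Section SquareIntegrable.
Context {R : realType}.
Implicit Types u v w f g : R -> R.
Local Notation mu := (@lebesgue_measure R).
Local Notation I := (@I01 R).

Definition summable01 f : Prop := mu.-integrable I (EFin \o f).
Definition int01 f : R := \int[mu]_(x in I) f x.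
Definition ip u v : R := int01 (fun x => u x * v x).

Lemma measurable_I01 : measurable (I : set (measurableTypeR R)).
Proof. exact: measurable_itv. Qed.
Hint Resolve measurable_I01 : core.

Lemma mu_I01 : mu I = 1%E.
Proof. by rewrite lebesgue_measure_itv/= lte_fin ltr01 oppr0 adde0. Qed.

Lemma summable01_measurable f : summable01 f -> measurable_fun I f.
Proof. by move=> /measurable_int /measurable_EFinP. Qed.

Lemma summable01_restrict f :
  summable01 f <-> mu.-integrable [set: R] (EFin \o (f \_ I)).
Proof. by rewrite -restrict_EFin; exact: integrable_mkcond. Qed.

Lemma restrict_sqr u : (fun x => u x ^+ 2) \_ I = (fun x => (u \_ I) x ^+ 2).
Proof. by apply/funext => x; rewrite /patch; case: ifP; rewrite ?expr0n. Qed.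

(** All later arguments use this description of L_2(0, 1), in which the
    exponent 2 is an integer power instead of a real one. *)
Lemma L2P u :
  L2 u <-> measurable_fun I u /\ summable01 (fun x => u x ^+ 2).
Proof.
rewrite /L2; split => [h|[mu1 /summable01_restrict iu]].
  have mu1 : measurable_fun I u.
    apply/measurable_restrictT => //.
    by move: h; rewrite inE => /andP[/[!inE]].
  split=> //; apply/summable01_restrict; rewrite restrict_sqr.
  exact: Lfun2_integrable_sqr h.
apply/andP; split; rewrite inE/=.
  exact/(measurable_restrictT u measurable_I01).
rewrite /finite_norm unlock poweR_lty//.
move: iu; rewrite restrict_sqr => /integrableP[_]; apply: le_lt_trans.
rewrite le_eqVlt; apply/orP; left; apply/eqP/eq_integral => x _ /=.
by rewrite powR_mulrn// normrX.
Qed.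

Lemma L2_measurable u : L2 u -> measurable_fun I u.
Proof. by move/L2P => []. Qed.

Lemma L2_sqr u : L2 u -> summable01 (fun x => u x ^+ 2).
Proof. by move/L2P => []. Qed.

Lemma summable01_le f g : measurable_fun I f -> summable01 g ->
  (forall x, I x -> `|f x| <= g x) -> summable01 f.
Proof.
move=> mf ig fg; apply: (@le_integrable _ _ _ mu I measurable_I01 _ (EFin \o g)) => //.
  exact/measurable_EFinP.
move=> x Ix /=; rewrite lee_fin.
by rewrite (le_trans (fg _ Ix))// ler_norm.
Qed.

Lemma summable01D f g : summable01 f -> summable01 g ->
  summable01 (fun x => f x + g x).
Proof. by move=> intf intg; exact: (integrableD measurable_I01 intf intg). Qed.

Lemma summable01B f g : summable01 f -> summable01 g ->
  summable01 (fun x => f x - g x).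
Proof. by move=> intf intg; exact: (integrableB measurable_I01 intf intg). Qed.

Lemma summable01Z c f : summable01 f -> summable01 (fun x => c * f x).
Proof. by move=> intf; exact: (integrableZl measurable_I01 c intf). Qed.

Lemma summable01_cst c : summable01 (fun=> c).
Proof.
apply: measurable_bounded_integrable => //.
  by move: mu_I01 => /= ->; rewrite ltry.
exact: bounded_cst.
Qed.

Lemma int01D f g : summable01 f -> summable01 g ->
  int01 (fun x => f x + g x) = int01 f + int01 g.
Proof. exact: RintegralD. Qed.

Lemma int01B f g : summable01 f -> summable01 g ->
  int01 (fun x => f x - g x) = int01 f - int01 g.
Proof. exact: RintegralB. Qed.

Lemma int01Z c f : summable01 f -> int01 (fun x => c * f x) = c * int01 f.
Proof. exact: RintegralZl. Qed.

Lemma int01_cst c : int01 (fun=> c) = c.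
Proof.
rewrite /int01 Rintegral_cst//; have /= -> := mu_I01.
by rewrite mulr1.
Qed.

Lemma le_int01 f g : summable01 f -> summable01 g ->
  (forall x, I x -> f x <= g x) -> int01 f <= int01 g.
Proof. exact: le_Rintegral. Qed.

Lemma int01_ge0 f : (forall x, I x -> 0 <= f x) -> 0 <= int01 f.
Proof. by move=> f0; exact: Rintegral_ge0. Qed.

Lemma eq_int01 f g : (forall x, I x -> f x = g x) -> int01 f = int01 g.
Proof. by move=> fg; apply: eq_Rintegral => x /set_mem; exact: fg. Qed.

Lemma ae01_sub (P Q : R -> Prop) : (forall x, I x -> P x -> Q x) ->
  {ae mu, forall x, I x -> P x} -> {ae mu, forall x, I x -> Q x}.
Proof.
move=> PQ; apply: filterS; first exact: (ae_filter_ringOfSetsType mu).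
by move=> x Px Ix; apply: PQ => //; exact: Px.
Qed.

Lemma ae01_sub2 (P Q S : R -> Prop) : (forall x, I x -> P x -> Q x -> S x) ->
  {ae mu, forall x, I x -> P x} -> {ae mu, forall x, I x -> Q x} ->
  {ae mu, forall x, I x -> S x}.
Proof.
move=> PQS; apply: filterS2; first exact: (ae_filter_ringOfSetsType mu).
by move=> x Px Qx Ix; apply: PQS => //; [exact: Px|exact: Qx].
Qed.

Lemma ae_eq_int01 f g : measurable_fun I f -> measurable_fun I g ->
  ae_eq01 f g -> int01 f = int01 g.
Proof.
move=> mf mg fg; congr fine; apply: ae_eq_integral => //.
- exact/measurable_EFinP.
- exact/measurable_EFinP.
- by apply: (ae01_sub _ fg) => x _ /= ->.
Qed.

Lemma int01_norm_le f : summable01 f -> `|int01 f| <= int01 (fun x => `|f x|).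
Proof. exact: le_normr_Rintegral. Qed.


Lemma L2M u v : L2 u -> L2 v -> summable01 (fun x => u x * v x).
Proof.
move=> hu hv; have su := L2_sqr hu; have sv := L2_sqr hv.
apply: (@summable01_le _ (fun x => u x ^+ 2 + v x ^+ 2)).
- by apply: measurable_funM; exact: L2_measurable.
- exact: summable01D.
- move=> x _; rewrite normrM.
  have := sqr_ge0 (`|u x| - `|v x|); rewrite sqrrB !real_normK ?num_real//.
  by have := mulr_ge0 (normr_ge0 (u x)) (normr_ge0 (v x)); lra.
Qed.

Lemma L2_le u v : measurable_fun I u -> L2 v ->
  (forall x, I x -> `|u x| <= `|v x|) -> L2 u.
Proof.
move=> mu1 hv uv; apply/L2P; split=> //.
apply: (@summable01_le _ (fun x => v x ^+ 2)); last 2 first.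
- exact: L2_sqr.
- move=> x Ix; rewrite normrX -(real_normK (num_real (v x))).
  by rewrite lerXn2r ?nnegrE//; exact: uv.
- exact: measurable_funX.
Qed.

Lemma L2_bounded u M : measurable_fun I u ->
  (forall x, I x -> `|u x| <= M) -> L2 u.
Proof.
move=> mu1 uM; apply: (@L2_le _ (fun=> M)) => //.
  apply/L2P; split; first exact: measurable_cst.
  exact: (summable01_cst (M ^+ 2)).
by move=> x Ix; rewrite (le_trans (uM _ Ix))// ler_norm.
Qed.

Lemma L2_cst c : L2 (fun=> c : R).
Proof. by apply: (@L2_bounded _ `|c|) => //; exact: measurable_cst. Qed.

Lemma L2D u v : L2 u -> L2 v -> L2 (fun x => u x + v x).
Proof.
move=> hu hv; have su := L2_sqr hu; have sv := L2_sqr hv.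
have m := measurable_funD (L2_measurable hu) (L2_measurable hv).
apply/L2P; split; first exact: m.
apply: (@summable01_le _ (fun x => 2 * u x ^+ 2 + 2 * v x ^+ 2)).
- exact: measurable_funX.
- by apply: summable01D; exact: summable01Z.
- move=> x _; rewrite ger0_norm ?sqr_ge0//.
  by have := sqr_ge0 (u x - v x); rewrite sqrrB sqrrD; lra.
Qed.

Lemma L2Z c u : L2 u -> L2 (fun x => c * u x).
Proof.
move=> hu; apply/L2P; split.
  by apply: measurable_funM; [exact: measurable_cst|exact: L2_measurable].
have -> : (fun x => (c * u x) ^+ 2) = (fun x => c ^+ 2 * u x ^+ 2).
  by apply/funext => x; rewrite exprMn.
by apply: summable01Z; exact: L2_sqr.
Qed.

Lemma L2B u v : L2 u -> L2 v -> L2 (fun x => u x - v x).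
Proof.
move=> hu hv; have := L2D hu (L2Z (-1) hv).
by congr L2; apply/funext => x; rewrite mulN1r.
Qed.

Lemma L2_mulb g u M : measurable_fun I g -> (forall x, I x -> `|g x| <= M) ->
  L2 u -> L2 (fun x => g x * u x).
Proof.
move=> mg gM hu; apply: (@L2_le _ (fun x => M * u x)).
- by apply: measurable_funM => //; exact: L2_measurable.
- exact: L2Z.
- move=> x Ix; rewrite !normrM ler_wpM2r//.
  by rewrite (le_trans (gM _ Ix))// ler_norm.
Qed.

Lemma L2_summable u : L2 u -> summable01 u.
Proof.
move=> hu; have := L2M hu (L2_cst 1).
by congr summable01; apply/funext => x; rewrite mulr1.
Qed.

Lemma ipC u v : ip u v = ip v u.
Proof. by apply: eq_int01 => x _; rewrite mulrC. Qed.

Lemma ae_eq_ip u u' v : L2 u -> L2 u' -> L2 v -> ae_eq01 u u' ->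
  ip u v = ip u' v.
Proof.
move=> hu hu' hv uu'; apply: ae_eq_int01.
- by apply: measurable_funM; exact: L2_measurable.
- by apply: measurable_funM; exact: L2_measurable.
- by apply: (ae01_sub _ uu') => x _ ->.
Qed.

Lemma ipDl u u' v : L2 u -> L2 u' -> L2 v ->
  ip (fun x => u x + u' x) v = ip u v + ip u' v.
Proof.
move=> hu hu' hv; rewrite /ip -int01D; [|exact: L2M|exact: L2M].
by apply: eq_int01 => x _; rewrite mulrDl.
Qed.

Lemma ipZl c u v : L2 u -> L2 v -> ip (fun x => c * u x) v = c * ip u v.
Proof.
move=> hu hv; rewrite /ip -int01Z; last exact: L2M.
by apply: eq_int01 => x _; rewrite mulrA.
Qed.

Lemma ipBl u u' v : L2 u -> L2 u' -> L2 v ->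
  ip (fun x => u x - u' x) v = ip u v - ip u' v.
Proof.
move=> hu hu' hv; rewrite /ip -int01B; [|exact: L2M|exact: L2M].
by apply: eq_int01 => x _; rewrite mulrBl.
Qed.

Lemma ipDr u v v' : L2 u -> L2 v -> L2 v' ->
  ip u (fun x => v x + v' x) = ip u v + ip u v'.
Proof. by move=> *; rewrite ipC ipDl// ipC [ip v' _]ipC. Qed.

Lemma ipZr c u v : L2 u -> L2 v -> ip u (fun x => c * v x) = c * ip u v.
Proof. by move=> *; rewrite ipC ipZl// ipC. Qed.

Lemma ipBr u v v' : L2 u -> L2 v -> L2 v' ->
  ip u (fun x => v x - v' x) = ip u v - ip u v'.
Proof. by move=> *; rewrite ipC ipBl// ipC [ip v' _]ipC. Qed.

Lemma ip_ge0 u : 0 <= ip u u.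
Proof. by apply: int01_ge0 => x _; rewrite -expr2 sqr_ge0. Qed.

Lemma ip_le u v : L2 u -> L2 v -> (forall x, I x -> `|u x| <= `|v x|) ->
  ip u u <= ip v v.
Proof.
move=> hu hv uv; apply: le_int01; [exact: L2M|exact: L2M|] => x Ix.
rewrite -!expr2 -(real_normK (num_real (u x))) -(real_normK (num_real (v x))).
by rewrite lerXn2r ?nnegrE//; exact: uv.
Qed.

Lemma ip_young u v : L2 u -> L2 v -> `|ip u v| <= (ip u u + ip v v) / 2.
Proof.
move=> hu hv.
have := ip_ge0 (fun x => u x + v x); have := ip_ge0 (fun x => u x - v x).
rewrite ipBl ?ipBr ?ipDl ?ipDr//; do ?[exact: L2D|exact: L2B].
by rewrite [ip v u]ipC ler_norml => *; apply/andP; split; lra.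
Qed.

Lemma cauchy_schwarz u v : L2 u -> L2 v -> (ip u v) ^+ 2 <= ip u u * ip v v.
Proof.
move=> hu hv; have v0 := ip_ge0 v.
have q a b : 0 <= a ^+ 2 * ip u u - 2 * a * b * ip u v + b ^+ 2 * ip v v.
  have := ip_ge0 (fun x => a * u x - b * v x).
  have ha := L2Z a hu; have hb := L2Z b hv.
  rewrite ipBl ?ipBr ?ipZl ?ipZr//; last exact: L2B.
  by rewrite [ip v u]ipC; lra.
have [v00|vn0] := eqVneq (ip v v) 0.
  have := q (ip u v) ((1 + ip u u) / 2); rewrite v00 !mulr0 addr0.
  by lra.
have := q (ip v v) (ip u v).
have vgt0 : 0 < ip v v by rewrite lt_neqAle eq_sym vn0.
move=> h; rewrite -(ler_pM2l vgt0); lra.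
Qed.

Lemma L2norm_sqr u : L2 u -> L2norm u ^+ 2 = ip u u.
Proof.
move=> hu; rewrite /L2norm.
have hn : ('N[mu]_2%:E [EFin \o u \_ I] `^ 2 = (ip u u)%:E)%E.
  rewrite powR_Lnorm ?pnatr_eq0//.
  rewrite /ip /int01 /Rintegral fineK; last first.
    exact: (integrable_fin_num measurable_I01 (L2M hu hu)).
  rewrite [RHS]integral_mkcond; apply: eq_integral => x _.
  rewrite /patch/=; case: ifP => _.
    by rewrite powR_mulrn// -normrX ger0_norm ?sqr_ge0// expr2.
  by rewrite normr0 powR0// pnatr_eq0.
move: hn (@Lnorm_ge0 _ _ _ mu 2%:E (EFin \o u \_ I)).
case: ('N[mu]_2%:E [EFin \o u \_ I])%E => [r| |] //=.
  by rewrite lee_fin => -[<-] r0; rewrite powR_mulrn.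
by rewrite pnatr_eq0.
Qed.

Lemma L2norm_ge0 u : 0 <= L2norm u.
Proof. by apply: fine_ge0; exact: Lnorm_ge0. Qed.

Lemma L2normE u : L2 u -> L2norm u = Num.sqrt (ip u u).
Proof.
by move=> hu; rewrite -L2norm_sqr// sqrtr_sqr ger0_norm// L2norm_ge0.
Qed.

Lemma ip_le_norm u v : L2 u -> L2 v -> `|ip u v| <= L2norm u * L2norm v.
Proof.
move=> hu hv; rewrite -(ler_pXn2r (n := 2))// ?nnegrE//.
  by rewrite exprMn !L2norm_sqr// real_normK ?num_real// cauchy_schwarz.
by rewrite mulr_ge0// L2norm_ge0.
Qed.

Lemma L2normD u v : L2 u -> L2 v ->
  L2norm (fun x => u x + v x) <= L2norm u + L2norm v.
Proof.
move=> hu hv; rewrite -(ler_pXn2r (n := 2))// ?nnegrE ?addr_ge0 ?L2norm_ge0//.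
have huv := L2D hu hv.
rewrite sqrrD !L2norm_sqr// ipDl// !ipDr// [ip v u]ipC.
have := ip_le_norm hu hv; have := ler_norm (ip u v); lra.
Qed.

Lemma L2normZ c u : L2 u -> L2norm (fun x => c * u x) = `|c| * L2norm u.
Proof.
move=> hu; have hc := L2Z c hu.
by rewrite !L2normE// ipZl// ipZr// mulrA -expr2 sqrtrM ?sqr_ge0// sqrtr_sqr.
Qed.

Lemma L2normB u v : L2 u -> L2 v ->
  L2norm (fun x => u x - v x) <= L2norm u + L2norm v.
Proof.
move=> hu hv; have := L2normD hu (L2Z (-1) hv).
rewrite L2normZ// normrN1 mul1r; apply: le_trans.
by under [X in L2norm X]eq_fun do rewrite -mulN1r.
Qed.

Lemma eq_L2norm u v : (forall x, I x -> u x = v x) -> L2norm u = L2norm v.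
Proof.
move=> uv; rewrite /L2norm; do 2 f_equal.
by apply/funext => x; rewrite /patch/=; case: ifPn => // /set_mem/uv ->.
Qed.

Lemma ae_eq_L2norm u v : L2 u -> L2 v -> ae_eq01 u v -> L2norm u = L2norm v.
Proof.
move=> hu hv uv; rewrite !L2normE// (ae_eq_ip hu hv hu)//.
by rewrite ipC (ae_eq_ip hu hv hv).
Qed.

Lemma L2norm_eq0 u : L2 u -> L2norm u = 0 -> ae_eq01 u (cst 0).
Proof.
move=> hu u0; have i0 : ip u u = 0 by rewrite -L2norm_sqr// u0 expr0n.
have m2 : measurable_fun I (EFin \o (fun x => u x * u x)).
  by apply/measurable_EFinP; apply: measurable_funM; exact: L2_measurable.
have : ae_eq mu I (EFin \o (fun x => u x * u x)) (cst 0%E).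
  apply/(ae_eq_integral_abs mu measurable_I01 m2).
  transitivity (ip u u)%:E; last by rewrite i0.
  rewrite /ip /int01 /Rintegral fineK.
    apply: eq_integral => x _ /=.
    by rewrite ger0_norm// -expr2 sqr_ge0.
  exact: (integrable_fin_num measurable_I01 (L2M hu hu)).
by apply: ae01_sub => x _ /= [/eqP]; rewrite mulf_eq0 orbb => /eqP.
Qed.

End SquareIntegrable.
#[export] Hint Resolve measurable_I01 : core.

(** * Primitives of integrable functions *)

Section Primitive.
Context {R : realType}.
Implicit Types (a b f g : R -> R) (x y : R).
Local Notation mu := (@lebesgue_measure R).
Local Notation I := (@I01 R).

Lemma Rintegral_restrict01 f : int01 f = \int[mu]_x (f \_ I) x.
Proof. by rewrite /int01 Rintegral_mkcond. Qed.

Lemma restrictM f g : (fun x => f x * g x) \_ I = (fun x => f x * (g \_ I) x).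
Proof.
by apply/funext => x; rewrite /patch; case: ifP => // _; rewrite mulr0.
Qed.

(** The kernel is bounded, so that the product is integrable over the square
    as soon as both factors are integrable. *)
Lemma Fubini01 (k : R -> R -> R) a b :
  measurable_fun setT (fun p : R * R => k p.1 p.2) ->
  (forall x y, `|k x y| <= 1) -> summable01 a -> summable01 b ->
  int01 (fun x => b x * int01 (fun y => k x y * a y)) =
  int01 (fun y => a y * int01 (fun x => k x y * b x)).
Proof.
move=> mk k1 /summable01_restrict sa /summable01_restrict sb.
set A := a \_ I; set B := b \_ I.
pose f (p : R * R) := (k p.1 p.2 * A p.2 * B p.1)%:E.
have mA : measurable_fun setT A by have /measurable_int/measurable_EFinP := sa.
have mB : measurable_fun setT B by have /measurable_int/measurable_EFinP := sb.
have mf : measurable_fun setT f.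
  apply/measurable_EFinP; apply: measurable_funM; first apply: measurable_funM.
  - exact: mk.
  - exact: (measurableT_comp mA measurable_snd).
  - exact: (measurableT_comp mB measurable_fst).
have mkl x : measurable_fun setT (k x).
  exact: (measurableT_comp mk (measurable_pair1 x)).
have mkr y : measurable_fun setT (k ^~ y).
  exact: (measurableT_comp mk (measurable_pair2 y)).
have sk (h g : R -> R) : measurable_fun setT h -> (forall y, `|h y| <= 1) ->
    mu.-integrable setT (EFin \o g) ->
    mu.-integrable setT (EFin \o (fun y => h y * g y)).
  move=> mh h1 sg; have mg := measurable_int _ sg.
  apply: (@le_integrable _ _ _ mu setT measurableT _ (EFin \o g)) => //.
    apply/measurable_EFinP; apply: measurable_funM => //.
    exact/measurable_EFinP.
  by move=> y _ /=; rewrite lee_fin normrM ler_piMl.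
have intf : (mu \x mu)%E.-integrable setT f.
  apply: (iffRL (integrable12ltyP mu mu mf)).
  apply: (@le_lt_trans _ _
    (\int[mu]_x ((\int[mu]_y `|(A y)%:E|) * `|(B x)%:E|))%E).
    apply: ge0_le_integral => //.
    - by move=> x _; exact: integral_ge0.
    - have mf' : measurable_fun setT (abse \o f) by exact: measurableT_comp.
      by apply: (measurable_fun_fubini_tonelli_F (m2 := mu) _ mf') => x /=.
    - apply: measurable_funeM.
      by apply: measurableT_comp => //; exact/measurable_EFinP.
    move=> x _; rewrite muleC -ge0_integralZl//; last first.
      by apply: measurableT_comp => //; exact/measurable_EFinP.
    apply: ge0_le_integral => //.
    - apply: measurableT_comp => //.
      exact: (measurableT_comp mf (measurable_pair1 x)).
    - apply: measurable_funeM.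
      by apply: measurableT_comp => //; exact/measurable_EFinP.
    move=> y _ /=; rewrite -EFinM lee_fin !normrM mulrC.
    by rewrite ler_wpM2l// ler_piMl.
  rewrite ge0_integralZl//; last first.
    by apply: integral_ge0 => y _.
    by apply: measurableT_comp => //; exact/measurable_EFinP.
  move/integrableP : sa => [_ sa]; move/integrableP : sb => [_ sb].
  by rewrite lte_mul_pinfty ?integral_ge0// ge0_fin_numE// integral_ge0.
have := Fubini intf.
have inner c (h g : R -> R) : measurable_fun setT h ->
    (forall y, `|h y| <= 1) -> mu.-integrable setT (EFin \o (g \_ I)) ->
    (\int[mu]_y (h y * (g \_ I) y * c)%:E)%E
    = (c * int01 (fun y => h y * g y))%:E.
  move=> mh h1 sg; have shg := sk _ _ mh h1 sg.
  rewrite Rintegral_restrict01 restrictM -RintegralZl//.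
  rewrite /Rintegral fineK; first by apply: eq_integral => y _; rewrite mulrC.
  exact: (integrable_fin_num measurableT (integrableZl measurableT c shg)).
rewrite [X in X = _ -> _](_ : _ =
    \int[mu]_x (B x * int01 (fun y => k x y * a y))%:E)%E; last first.
  by apply: eq_integral => x _; rewrite -inner.
rewrite [X in _ = X -> _](_ : _ =
    \int[mu]_y (A y * int01 (fun x => k x y * b x))%:E)%E; last first.
  apply: eq_integral => y _; rewrite -inner//.
  by apply: eq_integral => x _; rewrite /f/= mulrAC.
move=> /(congr1 fine) h; rewrite !Rintegral_restrict01.
have rM g h' : (fun x => g x * h' x) \_ I = (fun x => (g \_ I) x * h' x).
  by apply/funext => x; rewrite /patch; case: ifP => // _; rewrite mul0r.
by rewrite !rM.
Qed.

(** Integration from 0 to [x], written as integration against a kernel rather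
    than over a variable interval so that Fubini applies. *)
Definition below x y : R := (y <= x)%R%:R.

Lemma belowT x y : y <= x -> below x y = 1.
Proof. by rewrite /below => ->. Qed.

Lemma belowF x y : x < y -> below x y = 0.
Proof. by rewrite /below leNgt => ->. Qed.

Lemma below_le1 x y : `|below x y| <= 1.
Proof. by have [/belowT|/belowF] := leP y x => ->; rewrite ?normr1 ?normr0. Qed.

Lemma below_indic x : below x = \1_`]-oo, x].
Proof.
apply/funext => y; rewrite /below indicE; congr ((nat_of_bool _)%:R).
by apply/idP/idP; rewrite inE/= in_itv.
Qed.

Lemma measurable_below2 : measurable_fun setT (fun p : R * R => below p.1 p.2).
Proof.
rewrite (_ : (fun _ => _) = (\1_[set p : R * R | p.2 <= p.1])).
  apply: measurable_indic; rewrite -[X in measurable X]setTI.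
  by apply: measurable_fun_le.
apply/funext => p; rewrite /below indicE; congr ((nat_of_bool _)%:R).
by apply/idP/idP; rewrite inE.
Qed.

Lemma measurable_below D x : measurable_fun D (below x).
Proof. by rewrite below_indic; apply: measurable_indic. Qed.

Definition prim a x : R := int01 (fun y => below x y * a y).

Lemma summable01_below a x :
  summable01 a -> summable01 (fun y => below x y * a y).
Proof.
move=> sa; apply: (@summable01_le _ _ (fun y => `|a y|)).
- apply: measurable_funM; first exact: measurable_below.
  exact: summable01_measurable.
- exact: integrable_norm.
- by move=> y _; rewrite normrM ler_piMl// below_le1.
Qed.

Lemma primT a x : 1 <= x -> prim a x = int01 a.
Proof.
move=> x1; apply: eq_int01 => y; rewrite /I01/= in_itv/= => /andP[_ y1].
by rewrite belowT ?mul1r// (le_trans (ltW y1) x1).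
Qed.

Lemma prim0 a x : x <= 0 -> prim a x = 0.
Proof.
move=> x0; rewrite -[RHS](int01_cst 0); apply: eq_int01 => y.
rewrite /I01/= in_itv/= => /andP[y0 _].
by rewrite belowF ?mul0r// (le_lt_trans x0 y0).
Qed.

Lemma prim_below a x y : y <= x -> prim (fun z => below x z * a z) y = prim a y.
Proof.
move=> yx; apply: eq_int01 => z _; have [zy|yz] := leP z y.
  by rewrite !belowT ?mul1r// (le_trans zy yx).
by rewrite [below y z]belowF// !mul0r.
Qed.

Lemma prim_norm_le a x : summable01 a -> `|prim a x| <= int01 (fun y => `|a y|).
Proof.
move=> sa; apply: (le_trans (int01_norm_le (summable01_below x sa))).
apply: le_int01; [|exact: integrable_norm|].
  by apply: integrable_norm; exact: summable01_below.
by move=> y _; rewrite normrM ler_piMl// below_le1.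
Qed.

Lemma primE a x : prim a x = \int[mu]_(y in `]-oo, x]) (a \_ I) y.
Proof.
rewrite /prim Rintegral_restrict01 restrictM [RHS]Rintegral_mkcond.
apply: eq_Rintegral => y _; rewrite [in RHS]/patch below_indic indicE.
by case: ifP => _; rewrite ?mul1r// mul0r.
Qed.

Lemma prim_continuous a : summable01 a ->
  {within `[0, 1], continuous (prim a)}.
Proof.
move=> sa.
have ia : mu.-integrable `[0, 1] (EFin \o (a \_ I)).
  by apply: integrableS (iffLR (summable01_restrict a) sa).
have := parameterized_integral_continuous ler01 ia.
apply: subspace_eq_continuous => x; rewrite inE/= in_itv/= => /andP[x0 x1].
rewrite /from_subspace primE /parameterized_integral.
rewrite Rintegral_mkcond [RHS]Rintegral_mkcond.
apply: eq_Rintegral => y _; rewrite /patch /I01 !mem_setE !in_itv/=.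
case: (ltP 0 y) => [/ltW ->//|y0] /=; by do 2 case: ifP.
Qed.

Lemma measurable_prim a : summable01 a -> measurable_fun I (prim a).
Proof.
move=> sa; have := prim_continuous sa.
move=> /(subspace_continuous_measurable_fun (measurable_itv _)).
by apply: measurable_funS => //; exact: subset_itv_oo_cc.
Qed.

Lemma summable01_mulb f g M : measurable_fun I g -> (forall x, I x -> `|g x| <= M) ->
  summable01 f -> summable01 (fun x => f x * g x).
Proof.
move=> mg gM sf; apply: (@summable01_le _ _ (fun x => M * `|f x|)).
- by apply: measurable_funM => //; exact: summable01_measurable.
- by apply: summable01Z; exact: integrable_norm.
- by move=> x Ix; rewrite normrM mulrC ler_wpM2r// gM.
Qed.

Lemma summable01_prim a b : summable01 a -> summable01 b ->
  summable01 (fun x => a x * prim b x).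
Proof.
move=> sa sb; apply: (summable01_mulb (measurable_prim sb)) => // x _.
exact: prim_norm_le.
Qed.

(** The diagonal is negligible, so the two triangles fill up the square. *)
Lemma int01_above b y : summable01 b ->
  int01 (fun x => below x y * b x) = int01 b - prim b y.
Proof.
move=> sb; rewrite /prim -int01B//; last exact: summable01_below.
have mb := summable01_measurable sb.
apply: ae_eq_int01.
- apply: measurable_funM => //.
  exact: (measurable_funS measurableT (@subsetT _ _)
    (measurableT_comp measurable_below2 (measurable_pair2 y))).
- apply: measurable_funB => //; apply: measurable_funM => //.
  exact: measurable_below.
exists [set y]; split => //; first exact: lebesgue_measure_set1.
move=> x /=; apply: contra_notP => /eqP xy _; move: xy; rewrite neq_lt => /orP[] xy.
  by rewrite belowF// belowT ?ltW// !mul0r mul1r subrr.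
by rewrite belowT ?ltW// belowF// mul0r mul1r subr0.
Qed.

Lemma int01_prim_parts a b : summable01 a -> summable01 b ->
  int01 (fun x => a x * prim b x) + int01 (fun x => prim a x * b x) =
  int01 a * int01 b.
Proof.
move=> sa sb.
have -> : int01 (fun x => prim a x * b x) =
    int01 (fun x => int01 b * a x - a x * prim b x).
  transitivity (int01 (fun x => b x * prim a x)).
    by apply: eq_int01 => x _; rewrite mulrC.
  rewrite (Fubini01 measurable_below2 below_le1 sa sb).
  by apply: eq_int01 => y _; rewrite int01_above// mulrBr mulrC.
rewrite int01B; [|exact: summable01Z|exact: summable01_prim].
by rewrite int01Z// mulrC addrC subrK mulrC.
Qed.

(** Cutting both integrands off at [x] reduces the product rule on [0, x] to
    integration by parts over the whole interval. *)
Lemma prim_mul a b x : summable01 a -> summable01 b ->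
  prim a x * prim b x = prim (fun y => a y * prim b y + prim a y * b y) x.
Proof.
move=> sa sb.
rewrite {1 2}/prim -int01_prim_parts; [|exact: summable01_below|exact: summable01_below].
rewrite -int01D; last 2 first.
- by apply: summable01_prim; exact: summable01_below.
- have := summable01_prim (summable01_below x sb) (summable01_below x sa).
  by congr summable01; apply/funext => y; rewrite mulrC.
apply: eq_int01 => y _.
have [yx|xy] := leP y x; first by rewrite !prim_below//; ring.
by rewrite belowF// !(mul0r, mulr0) addr0.
Qed.

Lemma ae_eq_prim a b : measurable_fun I a -> measurable_fun I b ->
  ae_eq01 a b -> prim a = prim b.
Proof.
move=> ma mb ab; apply/funext => x; apply: ae_eq_int01.
- by apply: measurable_funM => //; exact: measurable_below.
- by apply: measurable_funM => //; exact: measurable_below.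
- by apply: (ae01_sub _ ab) => y _ ->.
Qed.

Lemma primD a b x : summable01 a -> summable01 b ->
  prim (fun y => a y + b y) x = prim a x + prim b x.
Proof.
move=> sa sb; rewrite /prim -int01D; [|exact: summable01_below|exact: summable01_below].
by apply: eq_int01 => y _; rewrite mulrDr.
Qed.

Lemma primZ c a x : summable01 a -> prim (fun y => c * a y) x = c * prim a x.
Proof.
move=> sa; rewrite /prim -int01Z; last exact: summable01_below.
by apply: eq_int01 => y _; rewrite mulrCA.
Qed.

Lemma primB a b x : summable01 a -> summable01 b ->
  prim (fun y => a y - b y) x = prim a x - prim b x.
Proof.
move=> sa sb; rewrite /prim -int01B; [|exact: summable01_below|exact: summable01_below].
by apply: eq_int01 => y _; rewrite mulrBr.
Qed.

(** By Lebesgue differentiation, [a] is almost everywhere the derivative of its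
    primitive. *)
Lemma prim_eq0 a : summable01 a -> (forall x, I x -> prim a x = 0) ->
  ae_eq01 a (cst 0).
Proof.
move=> sa a0; have sA := iffLR (summable01_restrict a) sa.
have : forall y, mu.-integrable `]-oo, y] (EFin \o (a \_ I)).
  by move=> y; apply: integrableS sA.
move=> /FTC1Ny /(_ (integrable_locally measurable_I01 sa)).
apply: filterS; first exact: (ae_filter_ringOfSetsType mu).
move=> x [_ /= dF] Ix.
have -> : a x = (a \_ I) x by rewrite /patch mem_set.
rewrite -dF derive1E -[RHS](derive_cst 0 x 1).
apply: near_eq_derive; near=> y; rewrite -primE a0//.
by near: y; exact: near_in_itvoo.
Unshelve. all: by end_near. Qed.

End Primitive.

(** * Sobolev functions as primitives *)

Section WeakDerivatives.
Context {R : realType}.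
Implicit Types (a b c f g u v w phi : R -> R) (x y : R).
Local Notation mu := (@lebesgue_measure R).
Local Notation I := (@I01 R).

Lemma I01P x : I x <-> 0 < x < 1.
Proof. by rewrite /I01/= in_itv. Qed.

Lemma near_I01 x : I x -> \near x, I x.
Proof. by move=> Ix; apply: near_in_itvoo. Qed.

(** A continuous function that is nonzero at a point is nonzero on a ball,
    which is not negligible. *)
Lemma continuous_ae_eq0 c : {within `[0, 1], continuous c} ->
  ae_eq01 c (cst 0) -> forall x, 0 <= x <= 1 -> c x = 0.
Proof.
move=> /(continuous_within_itvP _ ltr01)[cc c0 c1] [B [mB B0 sB]].
have cI x : I x -> c x = 0.
  move=> Ix; apply/eqP/negP => /negP cx.
  have : \near x, I x /\ c x != 0.
    near=> y; split; first by near: y; exact: near_I01.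
    near: y; have cxc : {for x, continuous c} by exact: cc.
    apply: (cxc [set z | z != 0]); by apply: open_nbhs_nbhs.
  move=> /nbhs_ballP[e /= e0 be].
  have : (mu (ball x e) <= mu B)%E.
    apply: le_measure; rewrite ?inE//; first exact: measurable_ball.
    by move=> y /be[Iy cy]; apply: sB => /= /(_ Iy)/eqP; exact/negP.
  rewrite B0 (lebesgue_measure_ball _ (ltW e0)) lee_fin leNgt.
  by rewrite pmulrn_lgt0// e0.
have cE x : 0 <= x <= 1 -> I x \/ x = 0 \/ x = 1.
  rewrite I01P !le_eqVlt => /andP[].
  by move=> /predU1P[<-|->]; [right; left|move=> /predU1P[->|->]; auto].
move=> x /cE[xI|[->|->]]; first exact: cI.
- apply: (cvg_unique _ c0) => //; apply: cvg_near_cst; near=> y; apply: cI.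
  by apply/I01P/andP; split.
- apply: (cvg_unique _ c1) => //; apply: cvg_near_cst; near=> y; apply: cI.
  by apply/I01P/andP; split.
Unshelve. all: by end_near. Qed.

Lemma prim_derive f f' : {within `[0, 1], continuous f'} ->
  (forall x, 0 <= x <= 1 -> is_derive x 1 f (f' x)) ->
  forall x, 0 <= x <= 1 -> prim f' x = f x - f 0.
Proof.
move=> cf' df x /andP[]; rewrite le_eqVlt => /predU1P[<- _|x0 x1].
  by rewrite prim0// subrr.
have df0 y : y \in `[0, x] -> is_derive y 1 f (f' y).
  by rewrite in_itv/= => /andP[y0 yx]; apply: df; rewrite y0 (le_trans yx).
have cf : {within `[0, x], continuous f}.
  by apply: derivable_within_continuous => y /df0[].
have := @continuous_FTC2 _ f' f 0 x x0.
have s : `[0, x] `<=` `[0, 1] by apply: subset_itvl; rewrite bnd_simp.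
move=> /(_ (continuous_subspaceW s cf')).
have dLR : derivable_oo_LRcontinuous f 0 x.
  split; first by move=> y yx; have [] := df0 y (subset_itv_oo_cc yx).
  - by have /(continuous_within_itvP _ x0)[] := cf.
  - by have /(continuous_within_itvP _ x0)[] := cf.
have dE : {in `]0, x[, derive1 f =1 f'}.
  move=> y /subset_itv_oo_cc/df0[_]; by rewrite derive1E.
move=> /(_ dLR dE) /(congr1 fine) /= <-.
have if' : mu.-integrable `[0, x] (EFin \o f').
  apply: continuous_compact_integrable; first exact: segment_compact.
  exact: continuous_subspaceW cf'.
have -> : fine (\int[mu]_(y in `[0%R, x]) (f' y)%:E)%E = \int[mu]_(y in `[0, x]) f' y.
  by [].
rewrite -Rintegral_itv_obnd_cbnd; last first.
  by apply: integrableS if' => //; exact: subset_itv_oc_cc.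
move: x1; rewrite le_eqVlt => /predU1P[x1|x1].
  rewrite x1 primT// -Rintegral_itv_bndo_bndc//.
  by apply: integrableS if' => //; rewrite x1; exact: subset_itv_oo_cc.
rewrite primE Rintegral_mkcond [RHS]Rintegral_mkcond.
apply: eq_Rintegral => y _; rewrite /patch /I01 !mem_setE !in_itv/=.
case: (leP y x) => [yx|]; last by rewrite andbF.
by rewrite (le_lt_trans yx x1) !andbT.
Qed.

(** Membership in W^1_2(0, 1) as a relation: [a] is the weak derivative, [p] and
    [q] are the values of the continuous representative at 0 and 1.  Unlike
    [wderiv] and [trace], which are chosen, the relation is stable under
    linear combinations and products by its very form. *)
Definition H1 f a (p q : R) : Prop :=
  [/\ L2 f, L2 a, ae_eq01 f (fun x => p + prim a x) & q = p + int01 a].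

(** The continuous representatives agree everywhere, in particular at 0; the
    primitives of [a] and [a'] then agree, hence so do [a] and [a']. *)
Lemma H1_unique f a p q f' a' p' q' : H1 f a p q -> H1 f' a' p' q' ->
  ae_eq01 f f' -> [/\ ae_eq01 a a', p = p' & q = q'].
Proof.
move=> [hf ha fE ->] [hf' ha' fE' ->] ff'.
have sa := L2_summable ha; have sa' := L2_summable ha'.
pose c x := (p - p') + prim (fun y => a y - a' y) x.
have c0 : forall x, 0 <= x <= 1 -> c x = 0.
  apply: continuous_ae_eq0.
    have h := prim_continuous (summable01B sa sa').
    by move=> x; apply: cvgD; [exact: cvg_cst|exact: h].
  apply: (ae01_sub2 _ fE (ae01_sub2 _ fE' ff')); last first.
    by move=> x _ h1 h2; exact: (conj h1 h2).
  move=> x _ /= fx [fx' ffx]; rewrite /c primB//.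
  by have := ffx; rewrite fx fx'; lra.
have pp' : p = p'.
  by apply/eqP; rewrite -subr_eq0 -(c0 0) ?lexx ?ler01// /c prim0 ?addr0.
have P0 x : 0 <= x <= 1 -> prim (fun y => a y - a' y) x = 0.
  by move=> /c0; rewrite /c pp' subrr add0r.
split => //.
  have /prim_eq0 : forall x, I x -> prim (fun y => a y - a' y) x = 0.
    by move=> x /I01P/andP[x0 x1]; apply: P0; rewrite !ltW.
  move=> /(_ (summable01B sa sa')); apply: ae01_sub => x _ /= /eqP.
  by rewrite subr_eq0 => /eqP.
have := P0 1; rewrite lexx ler01 primT// int01B// pp' => /(_ isT); lra.
Qed.

Lemma H1D f a p q g b r s : H1 f a p q -> H1 g b r s ->
  H1 (fun x => f x + g x) (fun x => a x + b x) (p + r) (q + s).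
Proof.
move=> [hf ha fE ->] [hg hb gE ->]; split; [exact: L2D|exact: L2D| |].
  apply: (ae01_sub2 _ fE gE) => x _ /= -> ->.
  by rewrite primD; [ring|exact: L2_summable|exact: L2_summable].
by rewrite int01D; [ring|exact: L2_summable|exact: L2_summable].
Qed.

Lemma H1Z k f a p q : H1 f a p q ->
  H1 (fun x => k * f x) (fun x => k * a x) (k * p) (k * q).
Proof.
move=> [hf ha fE ->]; split; [exact: L2Z|exact: L2Z| |].
  apply: (ae01_sub _ fE) => x _ /= ->.
  by rewrite primZ ?mulrDr//; exact: L2_summable.
by rewrite int01Z ?mulrDr//; exact: L2_summable.
Qed.

Lemma H1B f a p q g b r s : H1 f a p q -> H1 g b r s ->
  H1 (fun x => f x - g x) (fun x => a x - b x) (p - r) (q - s).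
Proof.
move=> hf hg; have := H1D hf (H1Z (-1) hg).
rewrite !mulN1r; congr H1; apply/funext => x; by rewrite mulN1r.
Qed.

Lemma ip_parts f a p q g b r s : H1 f a p q -> H1 g b r s ->
  ip a g + ip f b = q * s - p * r.
Proof.
move=> [hf ha fE ->] [hg hb gE ->].
have sa := L2_summable ha; have sb := L2_summable hb.
have ma := summable01_measurable sa; have mb := summable01_measurable sb.
have -> : ip a g = int01 (fun x => r * a x + a x * prim b x).
  apply: ae_eq_int01.
  - by apply: measurable_funM => //; exact: L2_measurable.
  - apply: measurable_funD; apply: measurable_funM => //.
    exact: measurable_prim.
  - by apply: (ae01_sub _ gE) => x _ /= ->; rewrite mulrDr mulrC.
have -> : ip f b = int01 (fun x => p * b x + prim a x * b x).
  apply: ae_eq_int01.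
  - by apply: measurable_funM => //; exact: L2_measurable.
  - apply: measurable_funD; apply: measurable_funM => //.
    exact: measurable_prim.
  - by apply: (ae01_sub _ fE) => x _ /= ->; rewrite mulrDl.
have sab : summable01 (fun x => prim a x * b x).
  have := summable01_prim sb sa.
  by congr summable01; apply/funext => x; rewrite mulrC.
rewrite !int01D ?int01Z//; [|exact: summable01Z|exact: summable01Z|exact: summable01_prim].
have := int01_prim_parts sa sb; lra.
Qed.

(** The product rule, for a multiplier that is bounded together with its
    derivative, so that the products stay square integrable. *)
Lemma H1_mulb w w' (w0 w1 M : R) f a p q : H1 w w' w0 w1 ->
  (forall x, I x -> `|w x| <= M) -> (forall x, I x -> `|w' x| <= M) ->
  H1 f a p q ->
  H1 (fun x => w x * f x) (fun x => w' x * f x + w x * a x) (w0 * p) (w1 * q).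
Proof.
move=> [hw hw' wE ->] wM w'M [hf ha fE ->].
have sa := L2_summable ha; have sw' := L2_summable hw'.
have ma := summable01_measurable sa; have mw' := summable01_measurable sw'.
pose d x := p * w' x + (w0 * a x + (w' x * prim a x + prim w' x * a x)).
have s1 : summable01 (fun x => w' x * prim a x) by exact: summable01_prim.
have s2 : summable01 (fun x => prim w' x * a x).
  have := summable01_prim sa sw'.
  by congr summable01; apply/funext => x; rewrite mulrC.
have s3 := summable01D s1 s2.
have s4 := summable01D (summable01Z w0 sa) s3.
have sd : summable01 d := summable01D (summable01Z p sw') s4.
have L2d : L2 (fun x => w' x * f x + w x * a x).
  by apply: L2D; apply: L2_mulb; eauto; exact: L2_measurable.
have dE : ae_eq01 (fun x => w' x * f x + w x * a x) d.
  apply: (ae01_sub2 _ wE fE) => x _ /= -> ->; rewrite /d; ring.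
have mE : forall x, prim (fun x => w' x * f x + w x * a x) x = prim d x.
  move=> x; congr (_ x); apply: ae_eq_prim => //; first exact: L2_measurable.
  exact: summable01_measurable.
have dprim x : prim d x = p * prim w' x + (w0 * prim a x + prim w' x * prim a x).
  rewrite /d primD//; [|exact: summable01Z].
  rewrite primZ// primD//; [|exact: summable01Z].
  by rewrite primZ// prim_mul.
split => //.
- by apply: L2_mulb wM hf; exact: L2_measurable.
- apply: (ae01_sub2 _ wE fE) => x _ /= -> ->; rewrite mE dprim; ring.
- by rewrite -(@primT _ (fun x => w' x * f x + w x * a x) 1)// mE dprim !primT//; ring.
Qed.

Lemma continuous01_bounded g : {within `[0, 1], continuous g} ->
  exists M, forall x, 0 <= x <= 1 -> `|g x| <= M.
Proof.
move=> cg; have := continuous_compact cg (@segment_compact _ 0 1).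
move=> /compact_bounded[M [_ Mg]]; exists (M + 1) => x x01.
by apply: Mg; [rewrite ltrDl|exists x; rewrite //= in_itv].
Qed.

Lemma continuous01_measurable g : {within `[0, 1], continuous g} ->
  measurable_fun I g.
Proof.
move=> /(subspace_continuous_measurable_fun (measurable_itv _)).
by apply: measurable_funS => //; exact: subset_itv_oo_cc.
Qed.

Lemma continuous01_L2 g : {within `[0, 1], continuous g} -> L2 g.
Proof.
move=> cg; have [M Mg] := continuous01_bounded cg.
apply: (L2_bounded (continuous01_measurable cg)) => x /I01P/andP[x0 x1].
by apply: Mg; rewrite !ltW.
Qed.

Lemma H1_C1 f f' : {within `[0, 1], continuous f'} ->
  (forall x, 0 <= x <= 1 -> is_derive x 1 f (f' x)) -> H1 f f' (f 0) (f 1).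
Proof.
move=> cf' df; have P := prim_derive cf' df; split.
- apply: continuous01_L2; apply: derivable_within_continuous => x.
  by rewrite in_itv/= => /df[].
- exact: continuous01_L2.
- apply: aeW => x /I01P/andP[x0 x1] /=.
  by rewrite P ?subrKC// !ltW.
- by rewrite -(@primT _ _ 1)// P ?subrKC// lexx ler01.
Qed.

(** * Functions with a weak derivative are primitives *)

Definition compactly_supported g : Prop :=
  exists a b : R, [/\ 0 < a, b < 1 & forall x, x \notin `[a, b] -> g x = 0].

Lemma summable01_continuousM w g : summable01 w -> continuous g ->
  summable01 (fun x => w x * g x).
Proof.
move=> sw cg; have cg' : {within `[0, 1], continuous g}.
  by apply: continuous_subspaceT; exact: cg.
have [M Mg] := continuous01_bounded cg'.
apply: (summable01_mulb (continuous01_measurable cg') _ sw) => x /I01P/andP[x0 x1].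
by apply: (Mg); rewrite !ltW.
Qed.

(** A continuous approximation of the indicator of [0, x], equal to 1 on
    [2/n, x - 1/n] and to 0 off [1/n, x]. *)
Definition plateau x n y : R :=
  Num.max 0 (Num.min 1 (Num.min (n%:R * y - 1) (n%:R * (x - y)))).

Lemma plateau_continuous x n : continuous (plateau x n).
Proof.
move=> y.
pose g (z : R) : R^o := n%:R * z - 1; pose h (z : R) : R^o := n%:R * (x - z).
suff : {for y, continuous ((fun=> 0 : R^o) \max ((fun=> 1 : R^o) \min (g \min h)))}.
  exact.
apply: continuous_max; first exact: cst_continuous.
apply: continuous_min; first exact: cst_continuous.
apply: continuous_min.
- by apply: cvgB; [apply: cvgM; [exact: cvg_cst|exact: cvg_id]|exact: cvg_cst].
- apply: cvgM; first exact: cvg_cst.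
  by apply: cvgB; [exact: cvg_cst|exact: cvg_id].
Qed.

Lemma plateau_ge0_le1 x n y : 0 <= plateau x n y <= 1.
Proof. by rewrite /plateau le_max lexx/= ge_max ler01/= ge_min lexx. Qed.

Lemma plateau_supported x n : x < 1 -> compactly_supported (plateau x n).
Proof.
move=> x1; exists (n.+1%:R)^-1, x; split => // y; rewrite in_itv/= negb_and -!ltNge => yx; apply/max_idPl.
rewrite !ge_min; apply/orP; right; apply/orP; case/orP: yx => yx.
  left; rewrite subr_le0; have [y0|/ltW y0] := leP 0 y; last first.
    by rewrite (le_trans _ ler01)// mulr_ge0_le0.
  have : n.+1%:R * y <= 1 by rewrite -ler_pdivlMl// mulr1 ltW.
  by apply: le_trans; rewrite ler_wpM2r// ler_nat.
by right; rewrite mulr_ge0_le0// subr_le0 ltW.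
Qed.

Lemma plateau_cvg x y : 0 < y -> y != x ->
  plateau x n y @[n --> \oo] --> below x y.
Proof.
move=> y0 yx.
have ny (c d : R) : 0 < c -> \forall n \near \oo, d <= n%:R * c.
  move=> c0; near=> n; rewrite -ler_pdivrMr//.
  by near: n; exact: nbhs_infty_ger.
apply: cvg_near_cst; move: yx; rewrite neq_lt => /orP[yx|xy].
  rewrite belowT ?ltW//; near=> n; rewrite /plateau.
  have h1 : 1 <= n%:R * y - 1.
    by rewrite lerBrDr; near: n; exact: ny.
  have h2 : 1 <= n%:R * (x - y) by near: n; apply: ny; rewrite subr_gt0.
  have -> : Num.min 1 (Num.min (n%:R * y - 1) (n%:R * (x - y))) = 1.
    by apply/min_idPl; rewrite le_min h1.
  exact/max_idPr.
rewrite belowF//; near=> n; apply/max_idPl; rewrite !ge_min.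
by rewrite mulr_ge0_le0 ?orbT// subr_le0 ltW.
Unshelve. all: by end_near. Qed.

(** Testing against the plateaus shows, in the limit, that the primitive of [w]
    vanishes. *)
Lemma duBoisReymond w : summable01 w ->
  (forall g, continuous g -> compactly_supported g ->
     int01 (fun x => w x * g x) = 0) -> ae_eq01 w (cst 0).
Proof.
move=> sw w0; apply: prim_eq0 => // x /I01P/andP[x0 x1].
have mw := summable01_measurable sw.
pose f n := EFin \o (fun y => w y * plateau x n y).
have mf n : measurable_fun I (f n).
  apply/measurable_EFinP; apply: summable01_measurable.
  exact: summable01_continuousM (@plateau_continuous x n).
have mg : measurable_fun I (EFin \o (fun y => below x y * w y)).
  by apply/measurable_EFinP; apply: measurable_funM => //; exact: measurable_below.
have cvf : {ae mu, forall y, I y ->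
    f n y @[n --> \oo] --> (EFin \o (fun y => below x y * w y)) y}.
  exists [set x]; split => //; first exact: lebesgue_measure_set1.
  move=> y /=; apply: contra_notP => /eqP yx /I01P/andP[y0 _].
  apply: cvg_EFin; first by apply: nearW.
  by rewrite mulrC; apply: cvgM; [exact: cvg_cst|exact: plateau_cvg].
have dom : {ae mu, forall y n, I y -> (`|f n y| <= (EFin \o (Num.norm \o w)) y)%E}.
  apply: aeW => y n Iy /=; rewrite lee_fin normrM ler_piMr//.
  by have /andP[p0 p1] := plateau_ge0_le1 x n y; rewrite ger0_norm.
have [_ _] := dominated_convergence measurable_I01 mf mg cvf
  (integrable_norm sw) dom.
have -> : [sequence (\int[mu]_(x0 in I) f n x0)%E]_n = cst 0%E.
  apply/funext => n /=.
  have := w0 _ (@plateau_continuous x n) (plateau_supported n x1).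
  rewrite /int01 /Rintegral => e; rewrite -[LHS]fineK ?e//.
  apply: (integrable_fin_num measurable_I01).
  exact: summable01_continuousM (@plateau_continuous x n).
move=> /(cvg_unique _ (cvg_cst 0%E)) => /(_ (@ereal_hausdorff _)).
by rewrite /prim /int01 /Rintegral => <-.
Qed.

Lemma compactly_supportedD f g (k : R) :
  compactly_supported f -> compactly_supported g ->
  compactly_supported (fun x => f x - k * g x).
Proof.
move=> [a [b [a0 b1 f0]]] [c [d [c0 d1 g0]]].
exists (Num.min a c), (Num.max b d).
split; [by rewrite lt_min a0|by rewrite gt_max b1|] => x.
rewrite in_itv/= negb_and -!ltNge lt_min gt_max => h.
have [xa xc] : (x < a) || (b < x) /\ (x < c) || (d < x).
  by case/orP: h => /andP[-> ->]; rewrite ?orbT.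
by rewrite f0 ?g0 ?mulr0 ?subrr// in_itv/= negb_and -!ltNge.
Qed.

Lemma supported01_restrict g : compactly_supported g -> g \_ I = g.
Proof.
move=> [a [b [a0 b1 g0]]]; apply/funext => x; rewrite /patch.
case: ifPn => //; rewrite notin_setE => xI; rewrite g0//.
apply/negP; rewrite in_itv/= => /andP[ax xb]; apply: xI; apply/I01P.
by rewrite (lt_le_trans a0 ax) (le_lt_trans xb b1).
Qed.

(** The mean is 0, so that the primitive vanishes again after the support. *)
Lemma test_function_prim g : continuous g -> compactly_supported g ->
  int01 g = 0 -> test_function (prim g) /\ derive1 (prim g) = g.
Proof.
move=> cg sg g0.
have ig : summable01 g.
  apply/L2_summable/continuous01_L2; apply: continuous_subspaceT; exact: cg.
have pE x : prim g x = \int[mu]_(y in `]-oo, x]) g y.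
  by rewrite primE (supported01_restrict sg).
have dp x : derivable (prim g) x 1 /\ derive1 (prim g) x = g x.
  have -> : prim g = fun x => \int[mu]_(y in `]-oo, x]) g y.
    by apply/funext => y; rewrite pE.
  apply: (@continuous_FTC1 _ _ _ x (x + 1)) => //; last exact: cg.
    by rewrite ltrDl.
  have := iffLR (summable01_restrict g) ig.
  by rewrite (supported01_restrict sg); apply: integrableS.
  exact: ltNyr.
have dE : derive1 (prim g) = g by apply: funext => z; exact: (dp z).2.
split => //; split; [by move=> x; exact: (dp x).1|by rewrite dE|].
have [a [b [a0 b1 gab]]] := sg; exists a, b; split => // x.
rewrite in_itv/= negb_and -!ltNge => /orP[xa|bx].
  rewrite -[RHS](int01_cst 0); apply: eq_int01 => y _.
  have [yx|xy] := leP y x; last by rewrite belowF// mul0r.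
  by rewrite gab ?mulr0// in_itv/= negb_and -ltNge (le_lt_trans yx xa).
rewrite -[RHS]g0; apply: eq_int01 => y _.
have [yx|xy] := leP y x; first by rewrite belowT// mul1r.
by rewrite gab ?mulr0// in_itv/= negb_and -!ltNge (lt_trans bx xy) orbT.
Qed.

(** Subtracting from [g] a multiple of a fixed [h] of nonzero mean produces the
    derivative of a test function.  Hence [w - c] is orthogonal to every [g],
    where [c] is the mean of [w] with weight [h]. *)
Lemma weak_deriv0_cst w : summable01 w -> is_weak_deriv w (cst 0) ->
  exists c : R, ae_eq01 w (cst c).
Proof.
move=> sw w0.
have w0' g : continuous g -> compactly_supported g -> int01 g = 0 ->
    int01 (fun x => w x * g x) = 0.
  move=> cg sg g0; have [tg dg] := test_function_prim cg sg g0.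
  have := w0 _ tg; rewrite dg => h; rewrite [LHS]h.
  rewrite -[RHS]oppr0; congr (- _); rewrite -[RHS](int01_cst 0).
  by apply: eq_int01 => x _; rewrite mul0r.
have s1 g : continuous g -> summable01 g.
  move=> cg; apply/L2_summable/continuous01_L2.
  by apply: continuous_subspaceT; exact: cg.
(* Without such an [h], the lemma of du Bois-Reymond would apply to the
   constant 1. *)
have [[h [ch sh h0]]|noh] := pselect (exists h : R -> R,
    [/\ continuous h, compactly_supported h & int01 h != 0]); last first.
  have : ae_eq01 (cst (1 : R)) (cst 0).
    apply: duBoisReymond => [|g cg sg]; first exact: summable01_cst.
    apply/eqP/negP => /negP g0; apply: noh; exists g; split => //.
    by move: g0; congr (_ != _); apply: eq_int01 => x _; rewrite mul1r.
  move=> /(ae_eq_int01 (measurable_cst _) (measurable_cst _)).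
  by rewrite !int01_cst => /eqP; rewrite oner_eq0.
exists (int01 (fun x => w x * h x) / int01 h); set c := _ / _.
have : ae_eq01 (fun x => w x - c) (cst 0).
  apply: duBoisReymond => [|g cg sg].
    by apply: summable01B => //; exact: summable01_cst.
  pose k := int01 g / int01 h.
  have ckh : continuous (fun x => k * h x).
    by move=> x; apply: cvgM; [exact: cvg_cst|exact: ch].
  have := w0' (fun x => g x - k * h x).
  have cgk : continuous (fun x => g x - k * h x).
    by move=> x; apply: cvgB; [exact: cg|exact: ckh].
  move=> /(_ cgk (compactly_supportedD k sg sh)).
  rewrite int01B ?int01Z; [|exact: s1|exact: s1|exact: s1].
  rewrite divfK// subrr => /(_ erefl) H.
  transitivity (int01 (fun x => w x * g x) - c * int01 g).
    rewrite -int01Z; last exact: s1.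
    rewrite -int01B; [|exact: summable01_continuousM|].
      by apply: eq_int01 => x _; rewrite mulrBl.
    by apply: summable01Z; exact: s1.
  transitivity (int01 (fun x => w x * g x) - k * int01 (fun x => w x * h x)).
    by rewrite /c /k; field.
  rewrite -int01Z; last exact: summable01_continuousM.
  rewrite -int01B; [|exact: summable01_continuousM|].
    by rewrite -[RHS]H; apply: eq_int01 => x _; rewrite mulrBr mulrCA.
  by apply: summable01Z; exact: summable01_continuousM.
by apply: ae01_sub => x _ /= /eqP; rewrite subr_eq0 => /eqP.
Qed.

Lemma test_function_continuous phi : test_function phi -> continuous phi.
Proof.
move=> [dphi _ _] x; apply/differentiable_continuous.
by rewrite -derivable1_diffP.
Qed.

Lemma is_weak_derivB u u' v v' : L2 u -> L2 u' -> L2 v -> L2 v' ->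
  is_weak_deriv u v -> is_weak_deriv u' v' ->
  is_weak_deriv (fun x => u x - u' x) (fun x => v x - v' x).
Proof.
move=> /L2_summable hu /L2_summable hu' /L2_summable hv /L2_summable hv' uv uv'.
move=> phi tphi.
have cphi := test_function_continuous tphi; have [_ cphi' _] := tphi.
have := uv _ tphi; have := uv' _ tphi.
rewrite -!/(int01 _) => e1 e2.
transitivity (int01 (fun x => u x * derive1 phi x) - int01 (fun x => u' x * derive1 phi x)).
  rewrite -int01B; [|exact: summable01_continuousM|exact: summable01_continuousM].
  by apply: eq_int01 => x _; rewrite mulrBl.
rewrite e1 e2 -opprD -int01B; [|exact: summable01_continuousM|exact: summable01_continuousM].
by congr (- _); apply: eq_int01 => x _; rewrite mulrBl.
Qed.

End WeakDerivatives.

(** * Weak derivatives, traces and Sobolev norms *)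

Section Sobolev1D.
Context {R : realType}.
Implicit Types (f g u v w a phi : R -> R) (p q x y : R) (z : R -> R -> R).
Local Notation mu := (@lebesgue_measure R).
Local Notation I := (@I01 R).

Lemma ae_eq01_refl u : ae_eq01 u u.
Proof. exact: aeW. Qed.

Lemma ae_eq01_sym u v : ae_eq01 u v -> ae_eq01 v u.
Proof. by apply: ae01_sub => x _ ->. Qed.

Lemma ae_eq01_trans v u w : ae_eq01 u v -> ae_eq01 v w -> ae_eq01 u w.
Proof. by apply: ae01_sub2 => x _ -> ->. Qed.

Lemma H1_ae f f' a p q : ae_eq01 f f' -> L2 f' -> H1 f a p q -> H1 f' a p q.
Proof.
move=> ff' hf' [hf ha fE qE]; split => //.
exact: (ae_eq01_trans (ae_eq01_sym ff') fE).
Qed.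

Lemma H1_weak_deriv f a p q : H1 f a p q -> is_weak_deriv f a.
Proof.
move=> hf phi tphi; have [_ cphi' [c [d [c0 d1 phi0]]]] := tphi.
have hphi : H1 phi (derive1 phi) (phi 0) (phi 1).
  apply: H1_C1; first by apply: continuous_subspaceT; exact: cphi'.
  move=> x _; rewrite derive1E; apply: DeriveDef => //.
  by have [] := tphi.
have := ip_parts hf hphi.
rewrite !phi0 ?in_itv/= ?negb_and -?ltNge ?c0 ?d1 ?orbT// !mulr0 subrr.
by rewrite /ip /int01 => /eqP; rewrite addrC addr_eq0 => /eqP.
Qed.

Lemma H1_prim v : L2 v -> H1 (prim v) v 0 (int01 v).
Proof.
move=> hv; split => //; last by rewrite add0r.
  exact/continuous01_L2/prim_continuous/L2_summable.
by apply: aeW => x _ /=; rewrite add0r.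
Qed.

(** The difference of [u] and the primitive of [v] has weak derivative 0. *)
Lemma weak_deriv_H1 u v : L2 u -> L2 v -> is_weak_deriv u v ->
  exists p, H1 u v p (p + int01 v).
Proof.
move=> hu hv uv; have hp := H1_prim hv; have [hpv _ _ _] := hp.
have := is_weak_derivB hu hpv hv hv uv (H1_weak_deriv hp).
have -> : (fun x => v x - v x) = cst 0 by apply/funext => x; rewrite subrr.
move=> /weak_deriv0_cst[|p pE].
  by apply: summable01B; exact: L2_summable.
exists p; split => //; apply: (ae01_sub _ pE) => x _ /= <-.
by rewrite subrK.
Qed.

Lemma wderiv_spec u : W 1 u -> L2 (wderiv u) /\ is_weak_deriv u (wderiv u).
Proof.
move=> [hu [v uv [hv _]]]; rewrite /wderiv.
by have := xgetPex (cst 0) (ex_intro [set v | L2 v /\ is_weak_deriv u v] v (conj hv uv)).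
Qed.

Lemma H1_W1 f a p q : H1 f a p q -> W 1 f.
Proof.
move=> h; have [hf ha _ _] := h; split => //.
by exists a => //; exact: H1_weak_deriv h.
Qed.

Lemma W1_H1 u : W 1 u -> exists p q, H1 u (wderiv u) p q.
Proof.
move=> Wu; have [hv uv] := wderiv_spec Wu; have [hu _] := Wu.
by have [p hp] := weak_deriv_H1 hu hv uv; exists p, (p + int01 (wderiv u)).
Qed.

Lemma H1_trace f a p q : H1 f a p q -> trace f 0 = p /\ trace f 1 = q.
Proof.
move=> [hf ha fE ->]; pose c x := p + prim a x.
have cc : {within `[0, 1], continuous c}.
  have h := prim_continuous (L2_summable ha).
  by move=> x; apply: cvgD; [exact: cvg_cst|exact: h].
have ex : exists d : R -> R, {within `[0 : R, 1], continuous d} /\ ae_eq01 d f.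
  by exists c; split => //; exact: ae_eq01_sym.
have [cd dE] := xgetPex (cst 0) ex; rewrite /trace /cont_repr.
set d := xget _ _ in cd dE *.
have dc x : 0 <= x <= 1 -> d x - c x = 0.
  apply: (@continuous_ae_eq0 _ (fun x => d x - c x)).
    by move=> y; apply: cvgB; [exact: cd|exact: cc].
  by apply: (ae01_sub2 _ dE fE) => y _ -> ->; rewrite /c subrr.
have := dc 0; rewrite lexx ler01 => /(_ isT)/eqP; rewrite subr_eq0 => /eqP ->.
have := dc 1; rewrite lexx ler01 => /(_ isT)/eqP; rewrite subr_eq0 => /eqP ->.
by rewrite /c prim0// primT// addr0.
Qed.

Lemma W1_traces u : W 1 u -> H1 u (wderiv u) (trace u 0) (trace u 1).
Proof. by move=> /W1_H1[p [q h]]; have [-> ->] := H1_trace h. Qed.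

Lemma H1_wderiv f a p q : H1 f a p q -> ae_eq01 a (wderiv f).
Proof.
move=> h; have h' := W1_traces (H1_W1 h).
by have [] := H1_unique h h' (ae_eq01_refl f).
Qed.

Lemma W1_ae u u' : ae_eq01 u u' -> L2 u' -> W 1 u -> W 1 u'.
Proof. by move=> uu' hu' /W1_traces/(H1_ae uu' hu')/H1_W1. Qed.

Lemma W2_wderiv u : W 2 u -> W 1 u /\ W 1 (wderiv u).
Proof.
move=> [hu [v uv Wv]]; have [hv _] := Wv.
have Wu : W 1 u by split => //; exists v.
have [hw _] := wderiv_spec Wu; split => //.
have [p hp] := weak_deriv_H1 hu hv uv.
exact: (W1_ae (H1_wderiv hp) hw Wv).
Qed.

Lemma W_L2 m u : W m u -> L2 u.
Proof. by case: m => [|m] []. Qed.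

Lemma Wnorm0 u : Wnorm 0 u = L2norm u.
Proof.
by rewrite /Wnorm big_ord1/= sqrtr_sqr ger0_norm// L2norm_ge0.
Qed.

Lemma Wnorm1_ge u : L2norm u <= Wnorm 1 u /\ L2norm (wderiv u) <= Wnorm 1 u.
Proof.
rewrite /Wnorm !big_ord_recr big_ord0/= add0r; split.
- rewrite -[leLHS]ger0_norm ?L2norm_ge0// -sqrtr_sqr ler_wsqrtr//.
  by rewrite lerDl sqr_ge0.
- rewrite -[leLHS]ger0_norm ?L2norm_ge0// -sqrtr_sqr ler_wsqrtr//.
  by rewrite lerDr sqr_ge0.
Qed.

Lemma int01_norm_le_L2norm u : L2 u -> int01 (fun x => `|u x|) <= L2norm u.
Proof.
move=> hu.
have hn : L2 (fun x => `|u x|).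
  apply: (L2_le _ hu) => [|x _]; last by rewrite normr_id.
  by apply: measurableT_comp => //; exact: L2_measurable.
have -> : int01 (fun x => `|u x|) = ip (fun x => `|u x|) (fun=> 1).
  by apply: eq_int01 => x _; rewrite mulr1.
apply: (le_trans (ler_norm _)); apply: (le_trans (ip_le_norm hn (L2_cst 1))).
rewrite [L2norm (fun=> 1)]L2normE; last exact: L2_cst.
rewrite /ip mulr1 int01_cst sqrtr1 mulr1 !L2normE//.
rewrite le_eqVlt; apply/orP; left; apply/eqP; congr Num.sqrt.
by apply: eq_int01 => x _; rewrite -normrM ger0_norm// -expr2 sqr_ge0.
Qed.

(** Average [p = f - prim a] over the interval. *)
Lemma H1_trace_le f a p q : H1 f a p q -> `|p| <= L2norm f + L2norm a.
Proof.
move=> [hf ha fE _]; have sa := L2_summable ha; have sf := L2_summable hf.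
have sp : summable01 (prim a).
  exact/L2_summable/continuous01_L2/prim_continuous.
have -> : p = int01 f - int01 (prim a).
  rewrite -int01B// -[LHS]int01_cst; apply: ae_eq_int01.
  - exact: measurable_cst.
  - by apply: summable01_measurable; exact: summable01B.
  - by apply: (ae01_sub _ fE) => x _ /= ->; rewrite addrK.
apply: (le_trans (ler_normB _ _)); apply: lerD.
  by apply: (le_trans (int01_norm_le sf)); exact: int01_norm_le_L2norm.
apply: (le_trans (int01_norm_le sp)).
apply: (le_trans _ (int01_norm_le_L2norm ha)).
rewrite -[leRHS]int01_cst; apply: le_int01.
- exact: integrable_norm.
- exact: summable01_cst.
- by move=> x _; exact: prim_norm_le.
Qed.

End Sobolev1D.

(** * Curves in L_2(0, 1) *)

Section L2Curves.
Context {R : realType}.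
Implicit Types (f g u v w : R -> R) (z : R -> R -> R) (t : R).
Local Notation I := (@I01 R).

(** Square integrability is asked for eventually only, because a curve is
    arbitrary outside of its lifespan. *)
Definition l2cvg {T : Type} (F : set_system T) (u : T -> R -> R) v : Prop :=
  [/\ \forall s \near F, L2 (u s), L2 v &
      L2norm (fun x => u s x - v x) @[s --> F] --> 0].

Section Limits.
Context {T : Type} (F : set_system T) {FF : ProperFilter F}.
Implicit Types (U V : T -> R -> R).

Lemma l2cvg_unique U v v' : l2cvg F U v -> l2cvg F U v' -> ae_eq01 v v'.
Proof.
move=> [hU hv Uv] [_ hv' Uv'].
have : ae_eq01 (fun x => v x - v' x) (cst 0).
  apply: (L2norm_eq0 (L2B hv hv')); apply/eqP; rewrite eq_le L2norm_ge0 andbT.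
  have Uvv' : L2norm (fun x => U s x - v x) + L2norm (fun x => U s x - v' x)
      @[s --> F] --> 0 by rewrite -[0]addr0; exact: cvgD.
  apply: (cvgr_to_ge Uvv'); near=> s.
  have hs : L2 (U s) by near: s.
  have := L2normB (L2B hs hv') (L2B hs hv); rewrite addrC; apply: le_trans.
  rewrite le_eqVlt; apply/orP; left; apply/eqP; apply: eq_L2norm => x _; ring.
by apply: ae01_sub => x _ /= /eqP; rewrite subr_eq0 => /eqP.
Unshelve. all: by end_near. Qed.

Lemma l2cvgD U V u v : l2cvg F U u -> l2cvg F V v ->
  l2cvg F (fun s x => U s x + V s x) (fun x => u x + v x).
Proof.
move=> [hU hu Uu] [hV hv Vv]; split; last 2 first.
- exact: L2D.
- have Z : L2norm (fun x => U s x - u x) + L2norm (fun x => V s x - v x)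
      @[s --> F] --> 0 by rewrite -[0]addr0; exact: cvgD.
  apply: (@squeeze_cvgr _ _ _ _ (cst 0)) Z; last exact: cvg_cst.
  near=> s; rewrite L2norm_ge0/=.
  have hs : L2 (U s) by near: s.
  have hs' : L2 (V s) by near: s.
  have := L2normD (L2B hs hu) (L2B hs' hv).
  by under [X in L2norm X <= _]eq_fun do rewrite addrACA -opprD.
- by near=> s; apply: L2D; near: s.
Unshelve. all: by end_near. Qed.

Lemma l2cvgM U u g M : measurable_fun I g -> (forall x, I x -> `|g x| <= M) ->
  l2cvg F U u -> l2cvg F (fun s x => g x * U s x) (fun x => g x * u x).
Proof.
move=> mg gM [hU hu Uu]; have L2g := L2_mulb mg gM.
split; [by near=> s; apply: L2g; near: s|exact: L2g|].
have Z : `|M| * L2norm (fun x => U s x - u x) @[s --> F] --> 0.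
  by rewrite -[0](mulr0 `|M|); apply: cvgM => //; exact: cvg_cst.
apply: (@squeeze_cvgr _ _ _ _ (cst 0)) Z; last exact: cvg_cst.
near=> s; rewrite L2norm_ge0/=; have hs : L2 (U s) by near: s.
have hd := L2B hs hu; rewrite -L2normZ//.
rewrite (@eq_L2norm _ _ (fun x => g x * (U s x - u x))); last first.
  by move=> x _; rewrite mulrBr.
rewrite !L2normE; [|exact: L2Z|exact: L2g]; rewrite ler_wsqrtr// ip_le//.
- exact: L2g.
- exact: L2Z.
- by move=> x Ix; rewrite !normrM ler_wpM2r// (le_trans (gM _ Ix))// ler_norm.
Unshelve. all: by end_near. Qed.

Lemma l2cvgZ U u k : l2cvg F U u ->
  l2cvg F (fun s x => k * U s x) (fun x => k * u x).
Proof. by apply: (@l2cvgM _ _ (fun=> k) `|k|) => //; exact: measurable_cst. Qed.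

Lemma l2cvgB U V u v : l2cvg F U u -> l2cvg F V v ->
  l2cvg F (fun s x => U s x - V s x) (fun x => u x - v x).
Proof.
move=> hU /(l2cvgZ (-1)) hV; have := l2cvgD hU hV.
congr (l2cvg _ _ _); last by apply/funext => x; rewrite mulN1r.
by apply/funext => s; apply/funext => x; rewrite mulN1r.
Qed.

Lemma eq_l2cvg U V u : (forall s x, U s x = V s x) -> l2cvg F U u -> l2cvg F V u.
Proof. by move=> UV; have -> : U = V by apply/funext => s; apply/funext. Qed.

Lemma l2cvg_cst u : L2 u -> l2cvg F (fun=> u) u.
Proof.
move=> hu; split; [exact: nearW|by []|].
have -> : L2norm (fun x => u x - u x) = 0; last exact: cvg_cst.
rewrite L2normE; last exact: L2B.
rewrite (_ : ip _ _ = 0) ?sqrtr0// -[RHS](int01_cst 0).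
by apply: eq_int01 => x _; rewrite subrr mul0r.
Qed.

Lemma l2cvg_ip U V u v : l2cvg F U u -> l2cvg F V v ->
  ip (U s) (V s) @[s --> F] --> ip u v.
Proof.
move=> [hU hu Uu] [hV hv Vv].
pose a s := L2norm (fun x => U s x - u x); pose b s := L2norm (fun x => V s x - v x).
have Z : a s * b s + a s * L2norm v + L2norm u * b s @[s --> F] --> 0.
  rewrite (_ : 0 = 0 * 0 + 0 * L2norm v + L2norm u * 0); last first.
    by rewrite !mulr0 mul0r !addr0.
  by apply: cvgD; [apply: cvgD|]; apply: cvgM => //; exact: cvg_cst.
suff Z' : `|ip (U s) (V s) - ip u v| @[s --> F] --> (0 : R).
  by apply/subr_cvg0; exact: norm_cvg0 Z'.
apply: (@squeeze_cvgr _ _ _ _ (cst 0)) Z; last exact: cvg_cst.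
near=> s; rewrite normr_ge0/=.
have hs : L2 (U s) by near: s.
have hs' : L2 (V s) by near: s.
have du := L2B hs hu; have dv := L2B hs' hv.
have -> : ip (U s) (V s) - ip u v =
    ip (fun x => U s x - u x) (fun x => V s x - v x)
    + ip (fun x => U s x - u x) v + ip u (fun x => V s x - v x).
  by rewrite !(ipBl, ipBr)//; ring.
apply: (le_trans (ler_normD _ _)); apply: lerD; last exact: ip_le_norm.
by apply: (le_trans (ler_normD _ _)); apply: lerD; exact: ip_le_norm.
Unshelve. all: by end_near. Qed.

End Limits.

Definition diffquot (U : R -> R -> R) t s x : R := (U s x - U t x) / (s - t).

(** The derivative is two-sided: the curves are studied at positive times. *)
Definition l2deriv (U : R -> R -> R) u t : Prop :=
  L2 (U t) /\ l2cvg t^' (diffquot U t) u.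

Lemma dnbhs_neq t : \forall s \near t^', s - t != 0.
Proof.
near=> s; rewrite subr_eq0; near: s; exact: nbhs_dnbhs_neq.
Unshelve. all: by end_near. Qed.

Lemma l2deriv_cvg U u t : l2deriv U u t -> l2cvg t^' U (U t).
Proof.
move=> [hUt [hq hu qu]].
have hU : \forall s \near t^', L2 (U s).
  near=> s; have hs : L2 (diffquot U t s) by near: s.
  have s0 : s - t != 0 by near: s; exact: dnbhs_neq.
  have := L2D hUt (L2Z (s - t) hs); congr L2; apply/funext => x.
  by rewrite /diffquot mulrC divfK// addrC subrK.
split => //.
have st : s - t @[s --> t^'] --> 0.
  by apply/subr_cvg0; exact: nbhs_dnbhs.
have Z : `|s - t| * (L2norm (fun x => diffquot U t s x - u x) + L2norm u)
    @[s --> t^'] --> 0.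
  rewrite -[0](mul0r (0 + L2norm u)).
  apply: cvgM; last by apply: cvgD => //; exact: cvg_cst.
  exact/norm_cvg0P.
apply: (@squeeze_cvgr _ _ _ _ (cst 0)) Z; last exact: cvg_cst.
near=> s; rewrite L2norm_ge0/=.
have hs : L2 (diffquot U t s) by near: s.
have s0 : s - t != 0 by near: s; exact: dnbhs_neq.
rewrite (@eq_L2norm _ _ (fun x => (s - t) * diffquot U t s x)); last first.
  by move=> x _; rewrite /diffquot mulrC divfK.
rewrite L2normZ// ler_wpM2l//.
have := L2normD (L2B hs hu) hu; apply: le_trans.
by rewrite le_eqVlt; apply/orP; left; apply/eqP; apply: eq_L2norm => x _; rewrite subrK.
Unshelve. all: by end_near. Qed.

Lemma quot_is_derive (f : R -> R) t (l : R) :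
  (f s - f t) / (s - t) @[s --> t^'] --> l -> is_derive t 1 f l.
Proof.
move=> /cvgr_dnbhsP h.
have c : h^-1 *: ((f \o shift t) (h *: 1) - f t) @[h --> 0^'] --> l.
  apply/cvgr_dnbhsP => u [un0 u0].
  have := h (fun n => u n + t).
  rewrite (_ : (fun n => _ / _) = (fun n => (u n)^-1 *: (f (u n *: 1 + t) - f t))).
    apply; split => [n|]; first by rewrite -subr_eq0 addrK.
    by rewrite -[X in _ --> X]add0r; apply: cvgD => //; exact: cvg_cst.
  by apply/funext => n; rewrite addrK mulrC /GRing.scale/= mulr1.
by apply: DeriveDef; [apply/cvg_ex; exists l|exact: cvg_lim].
Qed.

Lemma is_derive_ip U V u v t : l2deriv U u t -> l2deriv V v t ->
  is_derive t 1 (fun s => ip (U s) (V s)) (ip u (V t) + ip (U t) v).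
Proof.
move=> dU dV; have [hU qU] := dU; have [hV qV] := dV.
have cU := l2deriv_cvg dU; have cV := l2deriv_cvg dV.
apply: quot_is_derive.
have Z : ip (diffquot U t s) (V s) + ip (U t) (diffquot V t s) @[s --> t^']
    --> ip u (V t) + ip (U t) v.
  by apply: cvgD; apply: l2cvg_ip => //; exact: l2cvg_cst.
apply: cvg_trans Z; apply: near_eq_cvg; near=> s.
have s0 : s - t != 0 by near: s; exact: dnbhs_neq.
have hUs : L2 (U s) by near: s; case: cU.
have hVs : L2 (V s) by near: s; case: cV.
have quotE W : diffquot W t s = (fun x => (s - t)^-1 * (W s x - W t x)).
  by apply/funext => x; rewrite /diffquot mulrC.
rewrite !quotE ipZl ?ipZr//; do ?exact: L2B.
by rewrite ipBl// ipBr//; field.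
Unshelve. all: by end_near. Qed.

Lemma l2derivM U u g M t : measurable_fun I g -> (forall x, I x -> `|g x| <= M) ->
  l2deriv U u t -> l2deriv (fun s x => g x * U s x) (fun x => g x * u x) t.
Proof.
move=> mg gM [hU dU]; split; first exact: L2_mulb gM hU.
by apply: eq_l2cvg (l2cvgM mg gM dU) => s x; rewrite /diffquot mulrA mulrBr.
Qed.

Lemma l2derivB U V u v t : l2deriv U u t -> l2deriv V v t ->
  l2deriv (fun s x => U s x - V s x) (fun x => u x - v x) t.
Proof.
move=> [hU dU] [hV dV]; split; first exact: L2B.
by apply: eq_l2cvg (l2cvgB dU dV) => s x; rewrite /diffquot -mulrBl; congr (_ / _); ring.
Qed.

End L2Curves.

(** * Regular solutions at one instant *)

Section RegularCurves.
Context {R : realType}.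
Implicit Types (f g u v w : R -> R) (z : R -> R -> R) (s t : R) (T : \bar R).
Local Notation I := (@I01 R).

Lemma dnbhs_within t (F : R -> R) (l : R) : 0 < t ->
  F s @[s --> within [set s | 0 <= s /\ s != t] (nbhs t)] --> l ->
  F s @[s --> t^'] --> l.
Proof.
move=> t0 h A /h hA; have {}hA : nbhs t [set s | 0 <= s /\ s != t -> A (F s)] := hA.
have : nbhs t [set s | s != t -> A (F s)]; last by [].
near=> s => /= st; have : 0 <= s /\ s != t -> A (F s) by near: s.
apply; split => //; apply: ltW; near: s; exact: lt_nbhsr.
Unshelve. all: by end_near. Qed.

Lemma within_dnbhs t (F : R -> R) (l : R) :
  F s @[s --> t^'] --> l ->
  F s @[s --> within [set s | 0 <= s /\ s != t] (nbhs t)] --> l.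
Proof.
move=> h A /h hA; have {}hA : nbhs t [set s | s != t -> A (F s)] := hA.
have : nbhs t [set s | 0 <= s /\ s != t -> A (F s)]; last by [].
by apply: filterS hA => s hs [_]; exact: hs.
Qed.

Lemma is_tderiv_cvg m z t v : 0 < t -> is_tderiv m z t v ->
  Wnorm m (fun x => diffquot z t s x - v x) @[s --> t^'] --> 0.
Proof. by move=> t0; apply: dnbhs_within. Qed.

Lemma near_lifespan T t : 0 < t -> (t%:E < T)%E ->
  \forall s \near t, 0 < s /\ (s%:E < T)%E.
Proof.
move=> t0 tT; near=> s; split; first by near: s; exact: lt_nbhsr.
near: s; case: T tT => [r| |//].
  by rewrite lte_fin => tr; near=> s; rewrite lte_fin; near: s; exact: lt_nbhsl.
by move=> _; near=> s; exact: ltry.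
Unshelve. all: by end_near. Qed.

Lemma near_in_lifespan T t : 0 < t -> (t%:E < T)%E ->
  \forall s \near t^', 0 < s /\ (s%:E < T)%E.
Proof. by move=> t0 tT; apply: nbhs_dnbhs; exact: near_lifespan. Qed.

(** Limits in L_2 are unique up to almost everywhere equality, so that any
    derivative describes the chosen one. *)
Lemma tderivP z t v : 0 < t -> (\forall s \near t^', L2 (z s)) -> L2 (z t) ->
  L2 v -> is_tderiv 0 z t v ->
  l2deriv z (tderiv z t) t /\ ae_eq01 (tderiv z t) v.
Proof.
move=> t0 hz hzt hv dv.
have cvg0 u : L2 u -> is_tderiv 0 z t u -> l2cvg t^' (diffquot z t) u.
  move=> hu /(is_tderiv_cvg t0); under eq_fun do rewrite Wnorm0.
  split => //; near=> s; have hs : L2 (z s) by near: s.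
  have := L2Z (s - t)^-1 (L2B hs hzt); congr L2; apply/funext => x.
  by rewrite /diffquot mulrC.
have [hd dd] := xgetPex (cst 0)
  (ex_intro [set v | L2 v /\ is_tderiv 0 z t v] v (conj hv dv)).
have cd := cvg0 _ hd dd; split; first by split.
exact: (l2cvg_unique cd (cvg0 _ hv dv)).
Unshelve. all: by end_near. Qed.

Lemma is_tderiv_Wnorm1 z t v : is_tderiv 1 z t v -> is_tderiv 0 z t v.
Proof.
move=> h; apply: (@squeeze_cvgr _ _ _ _ (cst 0)) h; last exact: cvg_cst.
by apply: nearW => s; rewrite Wnorm0 L2norm_ge0/=; exact: (Wnorm1_ge _).1.
Qed.

Lemma H1_diffquot (z zx : R -> R -> R) t s (p q p' q' : R) :
  H1 (z s) (zx s) p q -> H1 (z t) (zx t) p' q' ->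
  H1 (diffquot z t s) (diffquot zx t s) ((p - p') / (s - t)) ((q - q') / (s - t)).
Proof.
move=> hs ht; have := H1Z (s - t)^-1 (H1B hs ht).
rewrite ![(s - t)^-1 * _]mulrC; congr H1; apply/funext => x;
by rewrite /diffquot mulrC.
Qed.

(** What the equation, the boundary condition on the left and the regularity
    of a curve [y] say at one instant: [yx], [yt] stand for its first
    derivatives, [f] for the forcing term, [b] and [c] for the values of
    [y_x] and [y_t] at the right end.  The class is stable under
    differences, hence contains the observation error. *)
Definition wave_at (k : R) (y yx yt : R -> R -> R) (f : R -> R) (t b c : R) :=
  exists yxx ytx ytt p q,
  [/\ [/\ l2deriv y (yt t) t, l2deriv yx ytx t & l2deriv yt ytt t],
      [/\ H1 (y t) (yx t) 0 q, H1 (yx t) yxx p b & H1 (yt t) ytx 0 c],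
      L2 f & ae_eq01 ytt (fun x => k * yxx x - f x)].

Lemma wave_atB k y yx yt f y' yx' yt' f' t b c b' c' :
  wave_at k y yx yt f t b c -> wave_at k y' yx' yt' f' t b' c' ->
  wave_at k (fun s x => y s x - y' s x) (fun s x => yx s x - yx' s x)
    (fun s x => yt s x - yt' s x) (fun x => f x - f' x) t (b - b') (c - c').
Proof.
move=> [yxx [ytx [ytt [p [q [[d1 d2 d3] [h1 h2 h3] hf E]]]]]].
move=> [yxx' [ytx' [ytt' [p' [q' [[d1' d2' d3'] [h1' h2' h3'] hf' E']]]]]].
exists (fun x => yxx x - yxx' x), (fun x => ytx x - ytx' x),
  (fun x => ytt x - ytt' x), (p - p'), (q - q'); split.
- by split; exact: l2derivB.
- split; first by rewrite -[X in H1 _ _ X](subrr 0); exact: H1B.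
  + exact: H1B.
  + by rewrite -[X in H1 _ _ X](subrr 0); exact: H1B.
- exact: L2B.
- by apply: (ae01_sub2 _ E E') => x _ -> ->; ring.
Qed.

Lemma sin_measurable u c : measurable_fun I u -> measurable_fun I (fun x => c * sin (u x)).
Proof.
move=> mu1; apply: measurable_funM; first exact: measurable_cst.
apply: measurableT_comp => //; apply: continuous_measurable_fun.
exact: continuous_sin.
Qed.

Lemma sin_L2 u c : L2 u -> L2 (fun x => c * sin (u x)).
Proof.
move=> hu; apply: (@L2_bounded _ _ `|c|); first by apply: sin_measurable; exact: L2_measurable.
by move=> x _; rewrite normrM ler_piMr// ler_norml sin_geN1 sin_le1.
Qed.

(** Regularity in W^1_2 and in L_2 provides two derivatives of [z], a priori
    unrelated to each other and to [tderiv]; uniqueness of limits in L_2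
    identifies them.  The trace of [z_t] at 0 vanishes, being a limit of traces
    of difference quotients, since traces are continuous in W^1_2. *)
Lemma regular_wave k beta T z t : regular T z -> 0 < t -> (t%:E < T)%E ->
  (forall s, 0 <= s -> (s%:E < T)%E -> trace (z s) 0 = 0) ->
  sine_Gordon k beta z t ->
  wave_at k z (fun s => wderiv (z s)) (tderiv z)
    (fun x => beta * sin (z t x)) t
    (trace (wderiv (z t)) 1) (trace (tderiv z t) 1).
Proof.
move=> [C02 [_ [w dw C01w]] [_ [w2 dw2 [C00w2 [w3 dw3 C00w3]]]]] t0 tT z0 SG.
have t0' := ltW t0.
have W2z s : 0 <= s -> (s%:E < T)%E -> W 2 (z s).
  by move=> s0 sT; have [] := C02.1 s s0 sT.
have W1z s : 0 <= s -> (s%:E < T)%E -> W 1 (z s).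
  by move=> s0 sT; have [] := W2_wderiv (W2z s s0 sT).
have L2z s : 0 <= s -> (s%:E < T)%E -> L2 (z s).
  by move=> s0 sT; exact: W_L2 (W2z s s0 sT).
have W1w s : 0 <= s -> (s%:E < T)%E -> W 1 (w s).
  by move=> s0 sT; have [] := C01w.1 s s0 sT.
have L2w2 s : 0 <= s -> (s%:E < T)%E -> L2 (w2 s).
  by move=> s0 sT; have [/W_L2] := C00w2 s s0 sT.
have nearL2 s : 0 < s -> (s%:E < T)%E -> \forall r \near s^', L2 (z r).
  move=> s0 sT; have := near_in_lifespan s0 sT; apply: filterS => r [r0 rT].
  by apply: L2z => //; exact: ltW.
have dz s : 0 < s -> (s%:E < T)%E -> l2deriv z (tderiv z s) s /\
    (ae_eq01 (tderiv z s) (w s) /\ ae_eq01 (tderiv z s) (w2 s)).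
  move=> s0 sT; have s0' := ltW s0; have nL := nearL2 s s0 sT.
  have hs := L2z s s0' sT.
  have [dzs e1] := tderivP s0 nL hs (W_L2 (W1w s s0' sT))
    (is_tderiv_Wnorm1 (dw s s0' sT)).
  by have [_ e2] := tderivP s0 nL hs (L2w2 s s0' sT) (dw2 s s0' sT).
have [dzt [ew ew2]] := dz t t0 tT.
have L2zt : L2 (tderiv z t) by have [_ []] := dzt.
have [W1zt W1zxt] := W2_wderiv (W2z t t0' tT).
have hz s : 0 <= s -> (s%:E < T)%E -> H1 (z s) (wderiv (z s)) 0 (trace (z s) 1).
  by move=> s0 sT; have := W1_traces (W1z s s0 sT); rewrite z0.
have hw := W1_traces (W1w t t0' tT).
pose err s :=
  H1 (fun x => diffquot z t s x - w t x)
        (fun x => diffquot (fun s => wderiv (z s)) t s x - wderiv (w t) x)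
        (- trace (w t) 0) ((trace (z s) 1 - trace (z t) 1) / (s - t) - trace (w t) 1).
have Q : \forall s \near t^', err s.
  have := near_in_lifespan t0 tT; apply: filterS => s [s0 sT].
  have := H1B (H1_diffquot (z := z) (zx := fun s => wderiv (z s)) (hz s (ltW s0) sT) (hz t t0' tT)) hw.
  by rewrite subrr mul0r sub0r.
have Wcvg := is_tderiv_cvg t0 (dw t t0' tT).
have cvgzx : l2cvg t^' (diffquot (fun s => wderiv (z s)) t) (wderiv (w t)).
  have [_ hwx _ _] := hw; split => //.
    have := near_in_lifespan t0 tT; apply: filterS => s [s0 sT].
    by have [_ ? _ _] := H1_diffquot (z := z) (zx := fun s => wderiv (z s)) (hz s (ltW s0) sT) (hz t t0' tT).
  apply: (@squeeze_cvgr _ _ _ _ (cst 0)) Wcvg; last exact: cvg_cst.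
  near=> s; rewrite L2norm_ge0/=.
  have Qs : err s by near: s.
  have [_ ? _ _] := Qs; have [_ ? _ _] := W1_traces (H1_W1 Qs).
  by rewrite (ae_eq_L2norm _ _ (H1_wderiv Qs))//; exact: (Wnorm1_ge _).2.
have w0 : trace (w t) 0 = 0.
  apply/eqP; rewrite -normr_eq0 eq_le normr_ge0 andbT.
  have Z : 2 * Wnorm 1 (fun x => diffquot z t s x - w t x) @[s --> t^'] --> 0.
    by rewrite -[0](mulr0 2); apply: cvgM => //; exact: cvg_cst.
  apply: (cvgr_to_ge Z); near=> s.
  have Qs : err s by near: s.
  have := H1_trace_le (W1_traces (H1_W1 Qs)).
  have [-> _] := H1_trace Qs; rewrite normrN.
  by have [] := Wnorm1_ge (fun x => diffquot z t s x - w t x); lra.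
have hzt : H1 (tderiv z t) (wderiv (w t)) 0 (trace (tderiv z t) 1).
  have h := H1_ae (ae_eq01_sym ew) L2zt hw.
  by rewrite w0 in h; have [_ ->] := H1_trace h.
have L2w3 : L2 (w3 t) by have [/W_L2] := C00w3.1 t t0' tT.
have L2ztn : \forall s \near t^', L2 (tderiv z s).
  have := near_in_lifespan t0 tT; apply: filterS => s [s0 sT].
  by have [[_ []]] := dz s s0 sT.
have cvgztt : l2cvg t^' (diffquot (tderiv z) t) (w3 t).
  have w3cvg := is_tderiv_cvg t0 (dw3 t t0' tT).
  split => //.
    near=> s; have hs : L2 (tderiv z s) by near: s.
    have := L2Z (s - t)^-1 (L2B hs L2zt); congr L2; apply/funext => x.
    by rewrite /diffquot mulrC.
  apply: cvg_trans w3cvg; apply: near_eq_cvg; near=> s.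
  have [s0 sT] : 0 < s /\ (s%:E < T)%E by near: s; exact: near_in_lifespan.
  have [[_ [_ hs _]] [_ ews]] := dz s s0 sT.
  have L2q (U : R -> R -> R) : L2 (U s) -> L2 (U t) -> L2 (diffquot U t s).
    move=> hUs hUt; have := L2Z (s - t)^-1 (L2B hUs hUt); congr L2.
    by apply/funext => x; rewrite /diffquot mulrC.
  rewrite Wnorm0; apply: ae_eq_L2norm.
  - by apply: L2B => //; apply: L2q; [exact: L2w2 (ltW s0) sT|exact: L2w2].
  - by apply: L2B => //; exact: L2q.
  - by apply: (ae01_sub2 _ ews ew2) => x _; rewrite /diffquot => -> ->.
have dztt : is_tderiv 0 (tderiv z) t (w3 t).
  apply: within_dnbhs; have [_ _] := cvgztt; apply: cvg_trans.
  by apply: near_eq_cvg; apply: nearW => s; rewrite Wnorm0.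
have [dtt _] := tderivP t0 L2ztn L2zt L2w3 dztt.
exists (wderiv (wderiv (z t))), (wderiv (w t)), (tderiv (tderiv z) t),
  (trace (wderiv (z t)) 0), (trace (z t) 1); split.
- split; [exact: dzt| |exact: dtt].
  by split; [have [] := hz t t0' tT|exact: cvgzx].
- by split; [exact: hz|exact: W1_traces|exact: hzt].
- by apply: sin_L2; exact: L2z.
- apply: (ae01_sub _ SG) => x _ /= e.
  by apply/eqP; rewrite -subr_eq0 -e; apply/eqP; ring.
Unshelve. all: by end_near. Qed.

End RegularCurves.

(** * Trigonometric inequalities *)

Section Trigonometry.
Context {R : realType}.
Implicit Types a b h x : R.

Lemma mvt_le (f f' g' : R -> R) (g : R -> R) a b : a <= b ->
  (forall x, is_derive x 1 f (f' x)) -> (forall x, is_derive x 1 g (g' x)) ->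
  (forall x, a <= x -> f' x <= g' x) -> f b - f a <= g b - g a.
Proof.
move=> ab df dg fg; pose u x := f x - g x.
have du x : is_derive x 1 u (f' x - g' x) by apply: is_deriveB.
have du1 x : derivable u x 1 by have [] := du x.
have uE x : derive1 u x = f' x - g' x by rewrite derive1E; have [_ ->] := du x.
have cu : {within `[a, +oo[, continuous u}.
  by apply: derivable_within_continuous => x _; exact: du1.
have : u b <= u a.
  apply: (ler0_derive1_nincry _ _ cu (lexx a) ab) => [x _|x]; first exact: du1.
  by rewrite in_itv/= andbT => /ltW ax; rewrite uE subr_le0 fg.
by rewrite /u; lra.
Qed.

Lemma lipschitz1 (f f' : R -> R) a b : (forall x, is_derive x 1 f (f' x)) ->
  (forall x, `|f' x| <= 1) -> `|f b - f a| <= `|b - a|.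
Proof.
move=> df f1.
have H c d : c <= d -> `|f d - f c| <= d - c.
  move=> cd; rewrite ler_norml; apply/andP; split.
  - rewrite lerNl opprB -[d - c](_ : id d - id c = _)//.
    have df' x : is_derive x 1 (fun y => - f y) (- f' x) by apply: is_deriveN.
    have := mvt_le cd df' (fun x => is_derive_id x 1).
    rewrite opprK addrC; apply => x _.
    by have := f1 x; rewrite ler_norml => /andP[]; lra.
  - apply: (mvt_le cd df (fun x => is_derive_id x 1)) => x _.
    by have := f1 x; rewrite ler_norml => /andP[].
have [ab|/ltW ba] := leP a b; first by rewrite (ger0_norm (_ : 0 <= b - a)) ?subr_ge0// H.
by rewrite distrC [leRHS]distrC (ger0_norm (_ : 0 <= a - b)) ?subr_ge0// H.
Qed.

Lemma sin_lipschitz a b : `|sin a - sin b| <= `|a - b|.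
Proof.
apply: (@lipschitz1 _ cos) => x.
by rewrite ler_norml cos_geN1 cos_le1.
Qed.

Lemma cos_lipschitz a b : `|cos a - cos b| <= `|a - b|.
Proof.
apply: (@lipschitz1 _ (fun x => - sin x)) => x.
by rewrite normrN ler_norml sin_geN1 sin_le1.
Qed.

Lemma sin_norm_le a : `|sin a| <= `|a|.
Proof. by have := sin_lipschitz a 0; rewrite sin0 !subr0. Qed.

Lemma is_derive_oppcos x : is_derive x 1 (fun y : R => - cos y) (sin x).
Proof. by rewrite -[sin x]opprK; exact: is_deriveN. Qed.

Lemma is_derive_halfsqr x : is_derive x 1 (fun y : R => y ^+ 2 / 2) x.
Proof.
have := is_deriveZ (2^-1) (is_deriveM (is_derive_id x (1 : R)) (is_derive_id x 1)).
rewrite (_ : _ \*: _ = (fun y : R => y ^+ 2 / 2)); last first.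
  by apply/funext => y; rewrite expr2 [RHS]mulrC.
by congr is_derive; rewrite /GRing.scale/=; field.
Qed.

Lemma one_sub_cos_le h : 1 - cos h <= h ^+ 2 / 2.
Proof.
wlog h0 : h / 0 <= h.
  move=> H; have [|/ltW h0] := leP 0 h; first exact: H.
  by rewrite -cosN -sqrrN; apply: H; rewrite oppr_ge0.
have := mvt_le h0 is_derive_oppcos is_derive_halfsqr.
rewrite cos0 expr0n mul0r subr0 opprK addrC; apply => x x0.
rewrite (le_trans (ler_norm _))// (le_trans (sin_norm_le x))//.
by rewrite ger0_norm.
Qed.

Lemma sub_sin_le h : `|h - sin h| <= h ^+ 2 / 2.
Proof.
wlog h0 : h / 0 <= h.
  move=> H; have [|/ltW h0] := leP 0 h; first exact: H.
  have := H (- h); rewrite oppr_ge0 sinN sqrrN => /(_ h0).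
  by rewrite -normrN; congr (`|_| <= _); ring.
rewrite ger0_norm; last first.
  by rewrite subr_ge0 (le_trans (ler_norm _))// (le_trans (sin_norm_le h))// ger0_norm.
have d1 x : is_derive x 1 (fun y => y - sin y) (1 - cos x).
  exact: (is_deriveB (is_derive_id x 1) (is_derive_sin x)).
have := mvt_le h0 d1 is_derive_halfsqr.
rewrite sin0 expr0n mul0r !subr0; apply => x x0.
have := mvt_le x0 is_derive_oppcos (fun y => is_derive_id y 1).
by rewrite cos0 opprK subr0 addrC; apply => y _; exact: sin_le1.
Qed.

(** The remainder is quadratic, hence of higher order in the L_2 norm; this is
    why the potential energy is differentiable along an L_2 derivative. *)
Lemma cos_taylor a b : `|cos b - cos a + sin a * (b - a)| <= (b - a) ^+ 2.
Proof.
pose h := b - a; have -> : b = a + h by rewrite /h addrC subrK.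
rewrite cosD -/h; have -> : a + h - a = h by ring.
have -> : cos a * cos h - sin a * sin h - cos a + sin a * h =
  sin a * (h - sin h) - cos a * (1 - cos h) by ring.
apply: (le_trans (ler_normB _ _)); rewrite [leRHS]splitr; apply: lerD.
- rewrite normrM (le_trans _ (sub_sin_le h))// ler_piMl//.
  by rewrite ler_norml sin_geN1 sin_le1.
- rewrite normrM (le_trans _ (one_sub_cos_le h))//.
  rewrite [`|1 - _|]ger0_norm ?subr_ge0 ?cos_le1// ler_piMl ?subr_ge0 ?cos_le1//.
  by rewrite ler_norml cos_geN1 cos_le1.
Qed.

End Trigonometry.

(** * The Wirtinger inequality and the dilation identity *)

Section Wirtinger.
Context {R : realType}.
Implicit Types (f a u v : R -> R) (m p q x : R).
Local Notation I := (@I01 R).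

Lemma is_derive_tan_affine m x : cos (m * (1 - x)) != 0 ->
  is_derive x 1 (fun y => m * tan (m * (1 - y)))
    (- (m ^+ 2 + (m * tan (m * (1 - x))) ^+ 2)).
Proof.
move=> cx.
have d1 : is_derive x 1 (fun y : R => m * (1 - y)) (- m).
  have := is_deriveZ m (is_deriveB (is_derive_cst (1 : R) x (1 : R)) (is_derive_id x 1)).
  by congr is_derive; rewrite /GRing.scale/= sub0r mulrN1.
have := is_deriveZ m (@is_derive1_comp _ tan (fun y => m * (1 - y)) x _ _ (is_derive_tan cx) d1).
by congr is_derive; rewrite /GRing.scale/= cos2_tan2//; ring.
Qed.

Lemma cos_affine_gt0 m x : 0 < m < pi / 2 -> 0 <= x <= 1 -> 0 < cos (m * (1 - x)).
Proof.
move=> /andP[m0 mpi] /andP[x0 x1]; apply: cos_gt0_pihalf; apply/andP; split.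
  apply: (@lt_le_trans _ _ 0); first by rewrite oppr_lt0 divr_gt0 ?pi_gt0.
  by rewrite mulr_ge0 ?subr_ge0// ltW.
apply: le_lt_trans mpi; rewrite ler_piMr ?(ltW m0)//; lra.
Qed.

(** Completing the square: [g := m * tan (m * (1 - x))] solves the Riccati
    equation [g' + g ^ 2 = - m ^ 2] and vanishes at the free end. *)
Lemma wirtinger_lt m u v q : 0 < m < pi / 2 -> H1 u v 0 q ->
  m ^+ 2 * ip u u <= ip v v.
Proof.
move=> mpi hu; pose g x := m * tan (m * (1 - x)).
pose g' x := - (m ^+ 2 + g x ^+ 2).
have dg x : 0 <= x <= 1 -> is_derive x 1 g (g' x).
  by move=> x01; apply: is_derive_tan_affine; rewrite gt_eqF// cos_affine_gt0.
have cg : {within `[0, 1], continuous g}.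
  by apply: derivable_within_continuous => x; rewrite in_itv/= => /dg[].
have cg' : {within `[0, 1], continuous g'}.
  move=> x; apply: cvgN; apply: cvgD; first exact: cvg_cst.
  by rewrite expr2; apply: cvgM; exact: cg.
have hg := H1_C1 cg' dg.
have [M Mg] := continuous01_bounded cg; have [M' Mg'] := continuous01_bounded cg'.
have I1 x : I x -> 0 <= x <= 1 by move=> /I01P/andP[x0 x1]; rewrite !ltW.
have gM x : I x -> `|g x| <= Num.max M M'.
  by move=> /I1 x01; rewrite le_max Mg.
have g'M x : I x -> `|g' x| <= Num.max M M'.
  by move=> /I1 x01; rewrite le_max Mg' ?orbT.
have hgu := H1_mulb hg gM g'M hu.
have [L2u L2v _ _] := hu; have [L2gu L2gu' _ _] := hgu.
have := ip_parts hu hgu.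
have -> : g 1 = 0 by rewrite /g subrr mulr0 tan0 mulr0.
rewrite !(mul0r, mulr0) subrr => P.
have L2g'u : L2 (fun x => g' x * u x).
  by apply: (L2_mulb (continuous01_measurable cg') (fun x Ix => Mg' x (I1 x Ix))).
have L2gv : L2 (fun x => g x * v x).
  by apply: (L2_mulb (continuous01_measurable cg) (fun x Ix => Mg x (I1 x Ix))).
rewrite ipDr// in P.
have e1 : ip u (fun x => g x * v x) = ip v (fun x => g x * u x).
  by apply: eq_int01 => x _; ring.
have e2 : ip (fun x => g x * u x) (fun x => g x * u x) =
    - ip u (fun x => g' x * u x) - m ^+ 2 * ip u u.
  have -> : ip u (fun x => g' x * u x) =
      ip u (fun x => - 1 * (m ^+ 2 * u x) - g x * (g x * u x)).
    by apply: eq_int01 => x _; rewrite /g'; ring.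
  have hgg : L2 (fun x => g x * (g x * u x)).
    by apply: (L2_mulb (continuous01_measurable cg) (fun x Ix => Mg x (I1 x Ix))).
  have h1 := L2Z (m ^+ 2) L2u; have h2 := L2Z (-1) h1.
  rewrite ipBr// !ipZr//.
  have -> : ip u (fun x => g x * (g x * u x)) = ip (fun x => g x * u x) (fun x => g x * u x).
    by apply: eq_int01 => x _; ring.
  by ring.
have := ip_ge0 (fun x => v x - g x * u x).
have L2d := L2B L2v L2gu.
rewrite ipBl// !ipBr// [ip (fun x => g x * u x) v]ipC e2.
by rewrite e1 in P; lra.
Qed.

(** The previous inequality for [m] close to [pi / 2]. *)
Lemma wirtinger u v q : H1 u v 0 q -> ip u u <= 4 / pi ^+ 2 * ip v v.
Proof.
move=> hu; have pi0 := pi_gt0 R; have pi2 : pi ^+ 2 > 0 :> R by rewrite exprn_gt0.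
set A := ip u u; set B := ip v v.
have h d : 0 < d < 1 -> (1 - d) ^+ 2 * (pi ^+ 2 * A) <= 4 * B.
  move=> /andP[d0 d1]; have := @wirtinger_lt ((1 - d) * (pi / 2)) u v q _ hu.
  rewrite -/A -/B !exprMn; have -> : (2^-1 : R) ^+ 2 = 4^-1 by field.
  have -> : 0 < (1 - d) * (pi / 2) < pi / 2.
    by apply/andP; split; nra.
  by move=> /(_ isT); lra.
have A0 : 0 <= pi ^+ 2 * A by rewrite mulr_ge0 ?ip_ge0// ltW.
suff : pi ^+ 2 * A <= 4 * B.
  by move=> AB; rewrite -[4 / _ * _]mulrAC ler_pdivlMr// mulrC.
rewrite leNgt; apply/negP => BA.
have B0 : 0 <= B := ip_ge0 _.
set X := pi ^+ 2 * A in h A0 BA.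
have X0 : 0 < X by apply: le_lt_trans BA; lra.
have := h ((X - 4 * B) / (4 * X)).
have -> : 0 < (X - 4 * B) / (4 * X) < 1.
  have X4 : 0 < 4 * X by lra.
  apply/andP; split; first by rewrite divr_gt0// subr_gt0.
  by rewrite ltr_pdivrMr//; lra.
move=> /(_ isT); set d := _ / _.
have dX : 4 * (d * X) = X - 4 * B by rewrite /d; field; rewrite gt_eqF.
have d0 : 0 <= d ^+ 2 * X by rewrite mulr_ge0 ?sqr_ge0// ltW.
rewrite sqrrB; lra.
Qed.

(** Integration by parts of [x * (f ^ 2)'], the weight [x] leaving only the
    value at the right end. *)
Lemma ip_dilation f a p q : H1 f a p q ->
  2 * ip (fun x => x * a x) f = q ^+ 2 - ip f f.
Proof.
move=> hf; have [L2f L2a _ _] := hf.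
have cid : {within `[0, 1], continuous (fun x : R => x)}.
  by apply: continuous_subspaceT => x; exact: cvg_id.
have hid : H1 (fun x : R => x) (fun=> 1) 0 1.
  apply: (@H1_C1 _ (fun x => x) (fun=> 1)).
  by apply: continuous_subspaceT => x; exact: cvg_cst.
have id1 x : I x -> `|x| <= 1.
  by move=> /I01P/andP[x0 x1]; rewrite ger0_norm ltW.
have one1 x : I x -> `|1 : R| <= 1 by rewrite normr1.
have hxf := H1_mulb hid id1 one1 hf.
have L2x u : L2 u -> L2 (fun x => x * u x).
  by apply: L2_mulb id1; exact: continuous01_measurable.
have := ip_parts hxf hf.
rewrite mul0r mul1r mul0r subr0 -expr2.
have -> : (fun x => 1 * f x + x * a x) = (fun x => f x + x * a x).
  by apply/funext => x; rewrite mul1r.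
rewrite ipDl//; [|exact: L2x].
have -> : ip (fun x => x * f x) a = ip (fun x => x * a x) f.
  by apply: eq_int01 => x _; ring.
lra.
Qed.

End Wirtinger.

(** * Energy identities *)

Section EnergyIdentities.
Context {R : realType}.
Implicit Types (f : R -> R) (y yx yt : R -> R -> R) (k t b c x : R).
Local Notation I := (@I01 R).

Lemma L2_dilate u : L2 u -> L2 (fun x : R => x * u x).
Proof.
apply: (L2_mulb (M := 1)); first exact: measurable_id.
by move=> x /I01P/andP[x0 x1]; rewrite ger0_norm ltW.
Qed.

Lemma ae_eq_ipr u u' v : L2 u -> L2 u' -> L2 (v : R -> R) -> ae_eq01 u u' ->
  ip v u = ip v u'.
Proof. by move=> hu hu' hv uu'; rewrite ipC (ae_eq_ip hu hu' hv uu') ipC. Qed.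

Definition wave_energy k yx yt (t : R) : R :=
  (ip (yt t) (yt t) + k * ip (yx t) (yx t)) / 2.

(** By the dilation identity, the time derivative of this functional contains
    the wave energy with a negative sign. *)
Definition multiplier yx yt (t : R) : R :=
  ip (fun x => x * yx t x) (yt t).

Lemma wave_energy_deriv k y yx yt f t b c : wave_at k y yx yt f t b c ->
  is_derive t 1 (wave_energy k yx yt) (k * b * c - ip f (yt t)).
Proof.
move=> [yxx [ytx [ytt [p [q [[d1 d2 d3] [h1 h2 h3] hf E]]]]]].
have [L2x L2xx _ _] := h2; have [L2t L2tx _ _] := h3.
have [_ [_ L2tt _]] := d3.
have := is_deriveZ (2^-1)
  (is_deriveD (is_derive_ip d3 d3) (is_deriveZ k (is_derive_ip d2 d2))).
rewrite (_ : _ \*: _ = wave_energy k yx yt); last first.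
  by apply/funext => s; rewrite /wave_energy [RHS]mulrC.
have L2r := L2B (L2Z k L2xx) hf.
congr is_derive; rewrite /GRing.scale/= [ip (yt t) ytt]ipC [ip (yx t) ytx]ipC.
have -> : ip ytt (yt t) = k * ip yxx (yt t) - ip f (yt t).
  by rewrite (ae_eq_ip L2tt L2r L2t E) ipBl ?ipZl//; exact: L2Z.
have := ip_parts h2 h3; rewrite mulr0 subr0 [ip (yx t) ytx]ipC.
move=> e; have -> : ip ytx (yx t) = b * c - ip yxx (yt t) by lra.
by field.
Qed.

Lemma multiplier_deriv k y yx yt f t b c : wave_at k y yx yt f t b c ->
  is_derive t 1 (multiplier yx yt)
    ((c ^+ 2 + k * b ^+ 2) / 2 - wave_energy k yx yt t
     - ip (fun x => x * yx t x) f).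
Proof.
move=> [yxx [ytx [ytt [p [q [[d1 d2 d3] [h1 h2 h3] hf E]]]]]].
have [L2x L2xx _ _] := h2; have [L2t L2tx _ _] := h3.
have [_ [_ L2tt _]] := d3.
have L2r := L2B (L2Z k L2xx) hf; have L2xyx := L2_dilate L2x.
have id1 x : I x -> `|x| <= 1.
  by move=> /I01P/andP[x0 x1]; rewrite ger0_norm ltW.
have mid : measurable_fun I (fun x : R => x) by exact: measurable_id.
have dm := l2derivM mid id1 d2.
have := is_derive_ip dm d3; congr is_derive.
have -> : ip (fun x => x * yx t x) ytt =
    k * ip (fun x => x * yxx x) (yx t) - ip (fun x => x * yx t x) f.
  rewrite (ae_eq_ipr L2tt L2r L2xyx E) ipBr ?ipZr//; last exact: L2Z.
  by congr (k * _ - _); apply: eq_int01 => x _; ring.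
have := ip_dilation h2; have := ip_dilation h3; rewrite /wave_energy.
move=> e1 e2.
have -> : ip (fun x => x * ytx x) (yt t) = (c ^+ 2 - ip (yt t) (yt t)) / 2 by lra.
have -> : ip (fun x => x * yxx x) (yx t) = (b ^+ 2 - ip (yx t) (yx t)) / 2 by lra.
by field.
Qed.

Lemma potential_deriv y v t : l2deriv y v t ->
  is_derive t 1 (fun s => int01 (fun x => 1 - cos (y s x)))
    (ip (fun x => sin (y t x)) v).
Proof.
move=> dy; have [hy cq] := dy; have [hqn hv _] := cq.
have [hyn _ _] := l2deriv_cvg dy.
have sc u : L2 u -> summable01 (fun x => 1 - cos (u x)).
  move=> hu; apply: L2_summable; apply: (@L2_bounded _ _ 2).
    apply: measurable_funB; first exact: measurable_cst.
    apply: measurableT_comp; last exact: L2_measurable.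
    by apply: continuous_measurable_fun; exact: continuous_cos.
  move=> x _; rewrite ger0_norm ?subr_ge0 ?cos_le1//.
  by have := cos_geN1 (u x); lra.
have ss u : L2 u -> L2 (fun x => sin (u x)).
  move=> hu; have := sin_L2 1 hu.
  by congr L2; apply/funext => x; rewrite mul1r.
apply: quot_is_derive.
have st : s - t @[s --> t^'] --> 0 by apply/subr_cvg0; exact: nbhs_dnbhs.
have Z1 : `|s - t| * ip (diffquot y t s) (diffquot y t s) @[s --> t^'] --> 0.
  rewrite -[0](mul0r (ip v v)); apply: cvgM; last exact: (l2cvg_ip cq cq).
  exact/norm_cvg0P.
have Z2 : ip (fun x => sin (y t x)) (diffquot y t s) @[s --> t^']
    --> ip (fun x => sin (y t x)) v.
  exact: (l2cvg_ip (l2cvg_cst (ss _ hy)) cq).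
pose E s := (int01 (fun x => 1 - cos (y s x)) - int01 (fun x => 1 - cos (y t x)))
  / (s - t) - ip (fun x => sin (y t x)) (diffquot y t s).
suff Z3 : `|E s| @[s --> t^'] --> (0 : R).
  have E0 : E s @[s --> t^'] --> 0 by apply: norm_cvg0; exact: Z3.
  have -> : (fun s => (int01 (fun x => 1 - cos (y s x))
      - int01 (fun x => 1 - cos (y t x))) / (s - t)) =
      (fun s => E s + ip (fun x => sin (y t x)) (diffquot y t s)).
    by apply/funext => s; rewrite /E subrK.
  by rewrite -[X in _ --> X]add0r; apply: cvgD.
apply: (@squeeze_cvgr _ _ _ _ (cst 0)) Z1; last exact: cvg_cst.
near=> s; rewrite normr_ge0/=.
have hys : L2 (y s) by near: s.
have hq : L2 (diffquot y t s) by near: s.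
have s0 : s - t != 0 by near: s; exact: dnbhs_neq.
have L2d := L2B hys hy.
rewrite /E /ip -int01B; [|exact: sc|exact: sc].
rewrite mulrC -int01Z; last exact: (summable01B (sc _ hys) (sc _ hy)).
rewrite -int01B; [| |exact: L2M (ss _ hy) hq]; last first.
  exact: summable01Z (summable01B (sc _ hys) (sc _ hy)).
rewrite -int01Z; last exact: L2M.
have S : summable01 (fun x => (s - t)^-1 * (1 - cos (y s x) - (1 - cos (y t x)))
    - sin (y t x) * diffquot y t s x).
  apply: summable01B; last exact: L2M (ss _ hy) hq.
  exact: summable01Z (summable01B (sc _ hys) (sc _ hy)).
apply: (le_trans (int01_norm_le S)); apply: le_int01.
- exact: integrable_norm.
- by apply: summable01Z; exact: L2M.
move=> x _; rewrite /diffquot.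
have -> : (s - t)^-1 * (1 - cos (y s x) - (1 - cos (y t x)))
    - sin (y t x) * ((y s x - y t x) / (s - t)) =
    - ((cos (y s x) - cos (y t x) + sin (y t x) * (y s x - y t x)) / (s - t)).
  by field.
rewrite normrN normrM normfV.
have -> : `|s - t| * ((y s x - y t x) / (s - t) * ((y s x - y t x) / (s - t))) =
    (y s x - y t x) ^+ 2 / `|s - t|.
  have n0 : `|s - t| != 0 by rewrite normr_eq0.
  have e : (s - t) ^+ 2 = `|s - t| ^+ 2 by rewrite real_normK ?num_real.
  transitivity (`|s - t| * (y s x - y t x) ^+ 2 / (s - t) ^+ 2); first by field.
  by rewrite e; field.
by rewrite ler_wpM2r ?invr_ge0// cos_taylor.
Unshelve. all: by end_near. Qed.

End EnergyIdentities.

(** * The multiplier estimate for the sine-Gordon equation *)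

Section Estimates.
Context {R : realType}.
Implicit Types (f u v : R -> R) (y yx yt z zx zt : R -> R -> R) (k beta t b c x : R).
Local Notation I := (@I01 R).

Lemma ip_young_weighted (l : R) u v : 0 < l -> L2 u -> L2 v ->
  `|2 * ip u v| <= l * ip u u + l^-1 * ip v v.
Proof.
move=> l0 hu hv.
have L2lu := L2Z l hu.
have := ip_ge0 (fun x => l * u x + v x); have := ip_ge0 (fun x => l * u x - v x).
rewrite ipBl// ?ipBr// ?ipDl// ?ipDr//; do ?[exact: L2B|exact: L2D].
rewrite !(ipZl, ipZr)// [ip v u]ipC => h1 h2.
have e : l * (l * ip u u + l^-1 * ip v v) = l * (l * ip u u) + ip v v.
  by rewrite mulrDr mulVKf// gt_eqF.
by rewrite ler_norml; apply/andP; split; rewrite -(ler_pM2l l0) ?mulrN e; lra.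
Qed.

Lemma cos_measurable u : measurable_fun I u -> measurable_fun I (fun x => cos (u x)).
Proof.
move=> mu1; apply: measurableT_comp => //.
by apply: continuous_measurable_fun; exact: continuous_cos.
Qed.

Lemma cos_L2 u : L2 u -> L2 (fun x => cos (u x)).
Proof.
move=> hu; apply: (@L2_bounded _ _ 1); first by apply: cos_measurable; exact: L2_measurable.
by move=> x _; rewrite ler_norml cos_geN1 cos_le1.
Qed.

Definition potential y t : R := int01 (fun x => 1 - cos (y t x)).

Definition mechanical k beta y yx yt t : R :=
  wave_energy k yx yt t + beta * potential y t.

Lemma energy_mechanical k beta z t :
  L2 (z t) -> L2 (wderiv (z t)) -> L2 (tderiv z t) ->
  energy k beta z t = mechanical k beta z (fun s => wderiv (z s)) (tderiv z) t.
Proof.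
move=> hz hx ht; rewrite /mechanical /wave_energy /potential.
have s1 := L2M ht ht; have s2 := L2M hx hx.
have s3 : summable01 (fun x => 1 - cos (z t x)).
  exact: L2_summable (L2B (L2_cst 1) (cos_L2 hz)).
have a1 := summable01Z 2^-1 s1; have a2 := summable01Z (k / 2) s2.
transitivity (int01 (fun x => 2^-1 * (tderiv z t x * tderiv z t x)
   + k / 2 * (wderiv (z t) x * wderiv (z t) x) + beta * (1 - cos (z t x)))).
  by apply: eq_int01 => x _; ring.
rewrite int01D; [|exact: summable01D|exact: summable01Z].
rewrite int01D// !int01Z// /ip. by field.
Qed.

Lemma potential_ge0 y t : 0 <= potential y t.
Proof. by apply: int01_ge0 => x _; rewrite subr_ge0 cos_le1. Qed.

Lemma potential_le y t : L2 (y t) -> potential y t <= ip (y t) (y t) / 2.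
Proof.
move=> hy; rewrite mulrC -int01Z; last exact: L2M.
apply: le_int01.
- exact: L2_summable (L2B (L2_cst 1) (cos_L2 hy)).
- by apply: summable01Z; exact: L2M.
by move=> x _; rewrite mulrC -expr2; exact: one_sub_cos_le.
Qed.

Lemma wave_energy_ge0 k yx yt t : 0 < k -> 0 <= wave_energy k yx yt t.
Proof.
move=> k0; rewrite /wave_energy divr_ge0// addr_ge0 ?ip_ge0//.
by rewrite mulr_ge0 ?ip_ge0// ltW.
Qed.

Lemma multiplier_le yx yt t : L2 (yx t) -> L2 (yt t) ->
  `|multiplier yx yt t| <= (ip (yx t) (yx t) + ip (yt t) (yt t)) / 2.
Proof.
move=> hx ht; have hxx := L2_dilate hx.
apply: (le_trans (ip_young hxx ht)).
rewrite ler_wpM2r ?invr_ge0// lerD2r; apply: ip_le => // x /I01P/andP[x0 x1].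
by rewrite normrM ler_piMl// ger0_norm ltW.
Qed.

Lemma wave_at_L2 k y yx yt f t b c : wave_at k y yx yt f t b c ->
  [/\ L2 (y t), L2 (yx t), L2 (yt t) &
      ip (y t) (y t) <= 4 / pi ^+ 2 * ip (yx t) (yx t)].
Proof.
move=> [yxx [ytx [ytt [p [q [_ [h1 h2 h3] _ _]]]]]].
by have [? ? _ _] := h1; have [? _ _ _] := h3; split=> //; exact: wirtinger h1.
Qed.

Lemma mechanical_deriv k beta y yx yt t b c :
  wave_at k y yx yt (fun x => beta * sin (y t x)) t b c ->
  is_derive t 1 (mechanical k beta y yx yt) (k * b * c).
Proof.
move=> w; have [L2y L2yx L2yt _] := wave_at_L2 w.
have dy : l2deriv y (yt t) t by have [? [? [? [? [? [[]]]]]]] := w.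
have := is_deriveD (wave_energy_deriv w) (is_deriveZ beta (potential_deriv dy)).
congr is_derive; rewrite /GRing.scale/= ipZl//; last first.
  by have := sin_L2 1 L2y; congr L2; apply/funext => x; rewrite mul1r.
by rewrite subrK.
Qed.

Lemma sin_forcing_ip beta u e v : 0 < beta -> L2 u -> L2 e -> L2 v ->
  (forall x, I x -> `|u x| <= `|e x|) ->
  `|ip (fun x => beta * u x) v| <= beta * (ip e e + ip v v) / 2.
Proof.
move=> beta0 hu he hv ue; rewrite ipZl// normrM (gtr0_norm beta0) -mulrA.
rewrite ler_wpM2l ?(ltW beta0)//; apply: (le_trans (ip_young hu hv)).
by rewrite ler_wpM2r ?invr_ge0// lerD2r ip_le.
Qed.

(** The multiplier identity with the sine term absorbed: up to boundary terms
    the multiplier decreases at a rate proportional to the energy. *)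
Lemma multiplier_dissipation k beta y yx yt t b c :
  0 < k -> 0 < beta ->
  wave_at k y yx yt (fun x => beta * sin (y t x)) t b c ->
  exists2 r, is_derive t 1 (multiplier yx yt) r &
    r <= (c ^+ 2 + k * b ^+ 2) / 2 - ip (yt t) (yt t) / 2
      - (k - (1 + 4 / pi ^+ 2) * beta) / 2 * ip (yx t) (yx t).
Proof.
move=> k0 beta0 w; have [L2y L2yx L2yt Wi] := wave_at_L2 w.
exists ((c ^+ 2 + k * b ^+ 2) / 2 - wave_energy k yx yt t
     - ip (fun x => x * yx t x) (fun x => beta * sin (y t x))).
  exact: multiplier_deriv w.
have L2s : L2 (fun x => sin (y t x)).
  by have := sin_L2 1 L2y; congr L2; apply/funext => x; rewrite mul1r.
have L2xyx := L2_dilate L2yx.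
have := sin_forcing_ip beta0 L2s L2y L2xyx (fun x _ => sin_norm_le (y t x)).
rewrite ipC ler_norml => /andP[+ _].
have dx : ip (fun x => x * yx t x) (fun x => x * yx t x) <= ip (yx t) (yx t).
  apply: ip_le => // x /I01P/andP[x0 x1].
  by rewrite normrM ler_piMl// ger0_norm ltW.
rewrite /wave_energy.
set S := ip (fun x => x * yx t x) _ in dx *.
set X := ip (fun x => x * yx t x) (fun x => beta * _).
move: Wi dx; set Y := ip (y t) (y t); set B := ip (yx t) (yx t).
move=> Wi dx hX.
have h1 : beta * (Y + S) <= beta * (4 / pi ^+ 2 * B + B).
  by rewrite ler_pM2l//; lra.
move: hX h1; set P := 4 / pi ^+ 2; lra.
Qed.

Lemma mechanical_ge0 k beta y yx yt t : 0 < k -> 0 < beta ->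
  0 <= mechanical k beta y yx yt t.
Proof.
move=> k0 beta0; apply: addr_ge0; first exact: wave_energy_ge0.
by rewrite mulr_ge0 ?potential_ge0// ltW.
Qed.

(** The same estimate in terms of the energy.  When [b] is proportional to [c],
    it bounds the energy by the velocity [c] of the end, in the mean over
    time. *)
Lemma multiplier_observability k beta : 0 < k -> 0 < beta ->
  (1 + 4 / pi ^+ 2) * beta < k ->
  exists c1 C : R, [/\ 0 < c1, 0 < C & forall y yx yt t b c,
    wave_at k y yx yt (fun x => beta * sin (y t x)) t b c ->
    `|multiplier yx yt t| <= C * mechanical k beta y yx yt t /\
    exists2 r, is_derive t 1 (multiplier yx yt) r &
      r <= (c ^+ 2 + k * b ^+ 2) / 2 - c1 * mechanical k beta y yx yt t].
Proof.
move=> k0 beta0; pose P : R := 4 / pi ^+ 2; rewrite -/P => kb.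
have P0 : 0 < P by rewrite divr_gt0// exprn_gt0// pi_gt0.
pose d := k - (1 + P) * beta.
have d0 : 0 < d by rewrite subr_gt0.
have e0 : 0 < k + beta * P by rewrite addr_gt0// mulr_gt0.
have k10 : 0 < k^-1 by rewrite invr_gt0.
exists (Num.min 1 (d / (k + beta * P))), (1 + k^-1).
set c1 := Num.min _ _.
have c10 : 0 < c1 by rewrite lt_min ltr01 divr_gt0.
have c11 : c1 <= 1 by rewrite ge_min lexx.
have c1d : c1 * (k + beta * P) <= d by rewrite -ler_pdivlMr// ge_min lexx orbT.
split => //; first by rewrite addr_gt0.
move=> y yx yt t b c w; have [L2y L2yx L2yt Wi] := wave_at_L2 w.
have p0 := potential_ge0 y t; have pP := potential_le L2y.
have A0 := ip_ge0 (yt t); have B0 := ip_ge0 (yx t).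
split.
  apply: (le_trans (multiplier_le L2yx L2yt)).
  apply: (@le_trans _ _ ((1 + k^-1) * wave_energy k yx yt t)); last first.
    rewrite ler_wpM2l ?addr_ge0 ?(ltW k10)// lerDl.
    by apply: mulr_ge0 => //; exact: ltW.
  have kk : k^-1 * (k * ip (yx t) (yx t)) = ip (yx t) (yx t).
    by rewrite mulKf// gt_eqF.
  rewrite /wave_energy.
  have h1 : 0 <= k^-1 * ip (yt t) (yt t) by apply: mulr_ge0 => //; exact: ltW.
  have h2 : 0 <= k * ip (yx t) (yx t) by apply: mulr_ge0 => //; exact: ltW.
  lra.
have [r dr rle] := multiplier_dissipation k0 beta0 w; exists r => //.
apply: (le_trans rle); rewrite -/P -/d -addrA -opprD lerD2l lerN2.
have m : mechanical k beta y yx yt t <=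
    ip (yt t) (yt t) / 2 + (k + beta * P) / 2 * ip (yx t) (yx t).
  have : beta * potential y t <= beta * (P * ip (yx t) (yx t) / 2).
    by rewrite ler_pM2l//; move: Wi; rewrite -/P; lra.
  rewrite /mechanical /wave_energy; lra.
have := ler_wpM2l (ltW c10) m.
have h1 : c1 * ip (yt t) (yt t) <= ip (yt t) (yt t) by rewrite ler_piMl.
have h2 : c1 * (k + beta * P) * ip (yx t) (yx t) <= d * ip (yx t) (yx t).
  by rewrite ler_wpM2r.
lra.
Qed.

End Estimates.

(** * The observation error *)

Section ObserverEstimates.
Context {R : realType}.
Implicit Types (z zx zt zh zhx zht : R -> R -> R).
Variables (k beta eps alpha : R).
Hypotheses (k0 : 0 < k) (beta0 : 0 < beta) (eps0 : 0 < eps).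
Hypotheses (beta_eps : beta < eps) (eps1 : eps < 1) (epsk : eps < k).
Hypothesis eta_eps : beta * (1 + eps) * (4 / pi ^+ 2) < eps * (k - beta).
Hypothesis alpha_eps : eps * k / 2 * alpha ^+ 2 - k * alpha + eps / 2 <= 0.

(** The wave energy alone is only dissipated at the boundary; the multiplier
    spreads the dissipation over the interval. *)
Definition lyapunov (ex et : R -> R -> R) (t : R) : R :=
  wave_energy k ex et t + eps * multiplier ex et t.

Lemma lyapunov_bounds ex et (t : R) : L2 (ex t) -> L2 (et t) ->
  (1 - eps) * ip (et t) (et t) + (k - eps) * ip (ex t) (ex t)
    <= 2 * lyapunov ex et t /\
  2 * lyapunov ex et t <=
    (1 + eps) * ip (et t) (et t) + (k + eps) * ip (ex t) (ex t).
Proof.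
move=> hx ht; have := multiplier_le hx ht; rewrite ler_norml => /andP[m1 m2].
rewrite /lyapunov /wave_energy; move: m1 m2; set m := multiplier _ _ _.
set A := ip (et t) _; set B := ip (ex t) _ => m1 m2.
have e1 : eps * - ((B + A) / 2) <= eps * m by rewrite ler_pM2l.
have e2 : eps * m <= eps * ((B + A) / 2) by rewrite ler_pM2l.
by split; lra.
Qed.

(** The boundary terms add up to the quadratic polynomial in [alpha] of
    [alpha_eps], times the square of the error velocity at the end.  Inside,
    the multiplier provides [eps * |e_t|^2 / 2], of which the forcing takes
    [beta * |e_t|^2 / 2], and [eps * k * |e_x|^2 / 2], of which by [eta_eps] and
    Wirtinger the forcing takes a fraction only. *)
Lemma lyapunov_decay : exists2 kappa : R, 0 < kappa &
  forall z zx zt zh zhx zht (t b c b' c' : R),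
  wave_at k z zx zt (fun x => beta * sin (z t x)) t b c ->
  wave_at k zh zhx zht (fun x => beta * sin (zh t x)) t b' c' ->
  b - b' = - alpha * (c - c') ->
  let V := lyapunov (fun s x => zx s x - zhx s x) (fun s x => zt s x - zht s x) in
  exists2 dV, is_derive t 1 V dV & dV <= - kappa * V t.
Proof.
pose P : R := 4 / pi ^+ 2.
have etaP : beta * (1 + eps) * P < eps * (k - beta) := eta_eps.
pose d1 := eps - beta; pose d2 := eps * (k - beta) - beta * (1 + eps) * P.
have d10 : 0 < d1 by rewrite subr_gt0.
have d20 : 0 < d2 by rewrite subr_gt0.
have e1 : 0 < 1 + eps by rewrite addr_gt0.
have e2 : 0 < k + eps by rewrite addr_gt0.
exists (Num.min (d1 / (1 + eps)) (d2 / (k + eps))).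
  by rewrite lt_min !divr_gt0.
set kappa := Num.min _ _.
have kd1 : kappa * (1 + eps) <= d1 by rewrite -ler_pdivlMr// ge_min lexx.
have kd2 : kappa * (k + eps) <= d2 by rewrite -ler_pdivlMr// ge_min lexx orbT.
have kappa0 : 0 < kappa by rewrite lt_min !divr_gt0.
move=> z zx zt zh zhx zht t b c b' c' w w' bc.
have we := wave_atB w w'; rewrite bc in we.
set ex := (fun s x => zx s x - zhx s x) in we *.
set et := (fun s x => zt s x - zht s x) in we *.
set e := (fun s x => z s x - zh s x) in we.
have [L2e L2ex L2et Wi] := wave_at_L2 we.
have [L2z _ _ _] := wave_at_L2 w; have [L2zh _ _ _] := wave_at_L2 w'.
set F := (fun x => _ - _) in we.
move=> V; exists (k * (- alpha * (c - c')) * (c - c') - ip F (et t) +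
  eps * (((c - c') ^+ 2 + k * (- alpha * (c - c')) ^+ 2) / 2 - wave_energy k ex et t
     - ip (fun x => x * ex t x) F)).
  exact: (is_deriveD (wave_energy_deriv we) (is_deriveZ eps (multiplier_deriv we))).
pose S x := sin (z t x) - sin (zh t x).
have ls u : L2 u -> L2 (fun x => sin (u x)).
  by move=> hu; have := sin_L2 1 hu; congr L2; apply/funext => x; rewrite mul1r.
have L2S : L2 S by apply: L2B; exact: ls.
have FS : F = (fun x => beta * S x) by apply/funext => x; rewrite /F /S mulrBr.
have Se x : `|S x| <= `|e t x| by exact: sin_lipschitz.
have L2xex := L2_dilate L2ex.
have := sin_forcing_ip beta0 L2S L2e L2et (fun x _ => Se x).
have := sin_forcing_ip beta0 L2S L2e L2xex (fun x _ => Se x).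
rewrite -FS ipC !ler_norml => /andP[+ _] /andP[+ _].
have dx : ip (fun x => x * ex t x) (fun x => x * ex t x) <= ip (ex t) (ex t).
  apply: ip_le => // x /I01P/andP[x0 x1].
  by rewrite normrM ler_piMl// ger0_norm ltW.
have [_ VU] := lyapunov_bounds L2ex L2et; rewrite -/V in VU.
rewrite /wave_energy.
move: Wi dx VU; rewrite -/P.
set C := ip (e t) (e t); set B := ip (ex t) (ex t); set A := ip (et t) (et t).
set D := ip (fun x => x * ex t x) (fun x => x * ex t x).
set X1 := ip _ F; set X2 := ip F _; set g := c - c'.
move=> Wi dx VU h1 h2.
have A0 : 0 <= A := ip_ge0 _.
have B0 : 0 <= B := ip_ge0 _.
have q : (eps * k / 2 * alpha ^+ 2 - k * alpha + eps / 2) * g ^+ 2 <= 0.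
  by rewrite mulr_le0_ge0// sqr_ge0.
have kV : 2 * (kappa * V t) <= d1 * A + d2 * B.
  apply: (@le_trans _ _ (kappa * ((1 + eps) * A + (k + eps) * B))).
    by rewrite mulrCA ler_pM2l.
  by rewrite mulrDr !mulrA lerD// ler_wpM2r.
have h1' : eps * - (beta * (C + D) / 2) <= eps * X1 by rewrite ler_pM2l.
have h3 : (1 + eps) * beta * C <= (1 + eps) * beta * (P * B).
  by rewrite ler_pM2l// mulr_gt0.
have h4 : eps * beta * D <= eps * beta * B by rewrite ler_pM2l// mulr_gt0.
move: kV; rewrite /d1 /d2; lra.
Qed.

Lemma lyapunov_ge0 ex et t : L2 (ex t) -> L2 (et t) -> 0 <= lyapunov ex et t.
Proof.
move=> hx ht; have [h _] := lyapunov_bounds hx ht.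
have : 0 <= (1 - eps) * ip (et t) (et t) + (k - eps) * ip (ex t) (ex t).
  by rewrite addr_ge0// mulr_ge0 ?ip_ge0// subr_ge0 ltW.
lra.
Qed.

(** The energies of plant and observer differ by little, relative to the
    energy itself, once the Lyapunov function is small. *)
Lemma energy_gap : exists2 C : R, 0 < C &
  forall z zx zt zh zhx zht (t b c b' c' l : R), 0 < l ->
  wave_at k z zx zt (fun x => beta * sin (z t x)) t b c ->
  wave_at k zh zhx zht (fun x => beta * sin (zh t x)) t b' c' ->
  `|mechanical k beta zh zhx zht t - mechanical k beta z zx zt t| <=
    l * (mechanical k beta z zx zt t + C) + (1 + l^-1) * C *
    lyapunov (fun s x => zx s x - zhx s x) (fun s x => zt s x - zht s x) t.
Proof.
pose P : R := 4 / pi ^+ 2.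
have P0 : 0 < P by rewrite divr_gt0// exprn_gt0// pi_gt0.
have e1 : 0 < 1 - eps by rewrite subr_gt0.
have e2 : 0 < k - eps by rewrite subr_gt0.
pose C1 := (1 - eps)^-1; pose C2 := (k + beta * P) / (k - eps).
have C10 : 0 < C1 by rewrite invr_gt0.
have C20 : 0 < C2 by rewrite divr_gt0// addr_gt0// mulr_gt0.
exists (C1 + C2 + beta); first by rewrite !addr_gt0.
move=> z zx zt zh zhx zht t b c b' c' l l0 w w'.
have we := wave_atB w w'.
set ex := (fun s x => zx s x - zhx s x) in we *.
set et := (fun s x => zt s x - zht s x) in we *.
set e := (fun s x => z s x - zh s x) in we.
have [L2e L2ex L2et Wi] := wave_at_L2 we.
have [L2z L2zx L2zt _] := wave_at_L2 w; have [L2zh L2zhx L2zht _] := wave_at_L2 w'.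
have dif (u v : R -> R) : L2 u -> L2 v -> let d := fun x => u x - v x in
    ip v v = ip u u - 2 * ip u d + ip d d.
  by move=> hu hv d; have hd : L2 d := L2B hu hv; rewrite /d !ipBr// !ipBl// [ip v u]ipC; ring.
have := dif _ _ L2zt L2zht; have := dif _ _ L2zx L2zhx.
have := ip_young_weighted l0 L2zt L2et; have := ip_young_weighted l0 L2zx L2ex.
have L2c : L2 (fun x => cos (z t x) - cos (zh t x)).
  by apply: L2B; exact: cos_L2.
have := ip_young_weighted l0 (L2_cst 1) L2c.
have -> : ip (fun=> 1) (fun=> 1) = 1 :> R by rewrite /ip mulr1 int01_cst.
have -> : ip (fun=> 1) (fun x => cos (z t x) - cos (zh t x)) =
    potential zh t - potential z t.
  rewrite /potential -int01B; last 2 first.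
  - exact: L2_summable (L2B (L2_cst 1) (cos_L2 L2zh)).
  - exact: L2_summable (L2B (L2_cst 1) (cos_L2 L2z)).
  by apply: eq_int01 => x _; ring.
have cc : ip (fun x => cos (z t x) - cos (zh t x)) (fun x => cos (z t x) - cos (zh t x))
    <= ip (e t) (e t).
  by apply: ip_le => // x _; exact: cos_lipschitz.
have [VL _] := lyapunov_bounds L2ex L2et.
have V0 := lyapunov_ge0 L2ex L2et.
have Kz : 0 <= wave_energy k zx zt t := wave_energy_ge0 _ _ _ k0.
have pz := potential_ge0 z t.
rewrite /mechanical; move: VL V0 Kz; rewrite /wave_energy; rewrite -/(ex t) -/(et t).
set V := lyapunov _ _ _; move: Wi cc; rewrite -/P.
set E := ip (e t) _; set D := ip (fun x => cos _ - cos _) _; set B := ip (ex t) (ex t); set A := ip (et t) (et t).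
set X1 := ip (zx t) (ex t); set X2 := ip (zt t) (et t).
set Z1 := ip (zx t) (zx t); set Z2 := ip (zt t) (zt t).
move: (potential z t) (potential zh t) pz => p ph p0.
move=> Wi cc VL V0 Kz hp hx ht -> ->.
have A0 : 0 <= A := ip_ge0 _.
have B0 : 0 <= B := ip_ge0 _.
have i0 : 0 < l^-1 by rewrite invr_gt0.
have AV : A <= 2 * C1 * V.
  rewrite -mulrA mulrCA ler_pdivlMl//.
  have : 0 <= (k - eps) * B by rewrite mulr_ge0// ltW.
  lra.
have BV : (k + beta * P) * B <= 2 * C2 * V.
  have kP : 0 < k + beta * P by rewrite addr_gt0// mulr_gt0.
  rewrite (_ : 2 * C2 * V = (k + beta * P) * ((k - eps)^-1 * (2 * V))); last first.
    by rewrite /C2; ring.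
  rewrite ler_pM2l// ler_pdivlMl//.
  have : 0 <= (1 - eps) * A by rewrite mulr_ge0// ltW.
  lra.
have kx : `|k * (2 * X1)| <= k * (l * Z1 + l^-1 * B).
  by rewrite normrM gtr0_norm// ler_pM2l.
have bp : `|beta * (2 * (ph - p))| <= beta * (l * 1 + l^-1 * D).
  by rewrite normrM gtr0_norm// ler_pM2l.
have bD : beta * (l^-1 * D) <= l^-1 * (beta * P * B).
  rewrite mulrCA ler_pM2l// -mulrA ler_pM2l//.
  exact: le_trans cc Wi.
have sum : A + (k + beta * P) * B <= 2 * ((C1 + C2 + beta) * V).
  have : 0 <= beta * V by rewrite mulr_ge0// ltW.
  lra.
have lsum : l^-1 * (A + (k + beta * P) * B) <= l^-1 * (2 * ((C1 + C2 + beta) * V)).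
  by rewrite ler_pM2l.
have PB : 0 <= beta * P * B.
  by apply: mulr_ge0 => //; apply: mulr_ge0; exact: ltW.
have kB : 0 <= k * B by apply: mulr_ge0 => //; exact: ltW.
have lp : 0 <= l * (beta * p).
  by apply: mulr_ge0; [exact: ltW|apply: mulr_ge0 => //; exact: ltW].
have lC : l * beta <= l * (C1 + C2 + beta).
  by rewrite ler_pM2l// lerDr; apply: addr_ge0; exact: ltW.
have lb : 0 <= l * beta by apply: mulr_ge0; exact: ltW.
move: sum lsum lC; move: (C1 + C2 + beta) => C sum lsum lC.
clear AV BV hp cc Wi VL dif.
move: kx ht bp; rewrite !ler_norml => /andP[kx1 kx2] /andP[ht1 ht2] /andP[bp1 bp2].
by apply/andP; split; lra.
Qed.

End ObserverEstimates.

(** * Monotonicity and barriers *)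

Section RealAnalysis.
Context {R : realType}.
Implicit Types (f df g : R -> R) (a b s t M : R).

Lemma nonincreasing_deriv f df a b : a <= b ->
  (forall s, a <= s <= b -> is_derive s 1 f (df s)) ->
  (forall s, a < s < b -> df s <= 0) -> f b <= f a.
Proof.
move=> ab hf hdf.
have d s : s \in `[a, b] -> derivable f s 1.
  by rewrite in_itv/= => sab; have [] := hf s sab.
have dE s : a < s < b -> derive1 f s = df s.
  by move=> /andP[sa sb]; rewrite derive1E; have [_ ->] := hf s (introT andP (conj (ltW sa) (ltW sb))).
apply: (@ler0_derive1_le_cc _ f a b) => //.
- by move=> s sab; apply: d; exact: subset_itv_oo_cc.
- by move=> s; rewrite in_itv/= => sab; rewrite dE// hdf.
- exact: derivable_within_continuous.
- by rewrite in_itv/= lexx ab.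
- by rewrite in_itv/= lexx ab.
Qed.

(** From the last time at which [f <= M] on, the function would be
    nonincreasing. *)
Lemma barrier f df M a b : a <= b ->
  (forall s, a <= s <= b -> is_derive s 1 f (df s)) ->
  (forall s, a <= s <= b -> M < f s -> df s <= 0) ->
  f a <= M -> f b <= M.
Proof.
move=> ab hf hdf faM; rewrite leNgt; apply/negP => Mfb.
have cf s : a <= s <= b -> {for s, continuous f}.
  by move=> /hf[ds _]; apply/differentiable_continuous; rewrite -derivable1_diffP.
pose S := [set s | a <= s <= b /\ f s <= M].
have Sa : S a by rewrite /S/= lexx ab.
have hS : has_sup S by split; [exists a|exists b => s [/andP[]]].
pose s0 := sup S.
have as0 : a <= s0 by apply: ub_le_sup => //; exact: hS.2.
have s0b : s0 <= b by apply: ge_sup; [exact: hS.1|move=> s [/andP[]]].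
have s0ab : a <= s0 <= b by rewrite as0.
have fs0 : f s0 <= M.
  rewrite leNgt; apply/negP => Mfs0.
  have : \forall s \near s0, M < f s.
    by apply: (cf _ s0ab [set x | M < x]); exact: lt_nbhsr.
  move=> /nbhs_ballP[e /= e0 be].
  have [s [[/andP[sa sb] fsM] es]] := sup_adherent e0 hS.
  have ss0 : s <= s0 by apply: ub_le_sup; [exact: hS.2|split => //; rewrite sa].
  have : M < f s.
    apply: be; rewrite /ball/= ger0_norm ?subr_ge0//.
    by move: es; rewrite -/s0; lra.
  by rewrite ltNge fsM.
suff : f b <= f s0 by rewrite leNgt (le_lt_trans fs0 Mfb).
apply: (@nonincreasing_deriv f df) => // s /andP[s0s sb].
  by apply: hf; rewrite (le_trans as0).
have sab : a <= s <= b by rewrite (le_trans as0 (ltW s0s)) ltW.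
apply: hdf => //; rewrite ltNge; apply/negP => fsM.
have : s <= s0 by apply: ub_le_sup; [exact: hS.2|split].
by rewrite leNgt s0s.
Qed.

Lemma no_linear_decrease f df a c M : 0 < c ->
  (forall s, a <= s -> is_derive s 1 f (df s)) ->
  (forall s, a <= s -> df s <= - c) -> (forall s, a <= s -> M <= f s) -> False.
Proof.
move=> c0 hf hdf hM.
pose b := a + (`|f a - M| + 1) / c.
have ab : a <= b by rewrite lerDl divr_ge0// ?(ltW c0)// addr_ge0.
have hg s : a <= s <= b -> is_derive s 1 (fun s => f s + c * s) (df s + c).
  move=> /andP[sa _].
  have := is_deriveD (hf s sa) (is_deriveZ c (is_derive_id s (1 : R))).
  by congr is_derive; rewrite /GRing.scale/= mulr1.
have := nonincreasing_deriv ab hg.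
have le0 s : a < s < b -> df s + c <= 0.
  by move=> /andP[/ltW sa _]; have := hdf s sa; lra.
move=> /(_ le0).
have -> : c * b = c * a + (`|f a - M| + 1) by rewrite /b; field; rewrite gt_eqF.
have := hM _ ab; have := ler_norm (f a - M); lra.
Qed.

Lemma continuous_signed_bounds (psi : R -> R) (sg a b : R) : a <= b ->
  continuous psi -> (forall s, a <= s <= b -> 0 < sg * psi s) ->
  exists m1 m2, 0 < m1 /\ forall s, a <= s <= b -> m1 <= sg * psi s <= m2.
Proof.
move=> ab cpsi pos.
have c : {within `[a, b], continuous (fun s => sg * psi s)}.
  apply: continuous_subspaceT => s; apply: cvgM; first exact: cvg_cst.
  exact: cpsi.
have [x1 x1ab h1] := EVT_min ab c; have [x2 x2ab h2] := EVT_max ab c.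
exists (sg * psi x1), (sg * psi x2); split; first by apply: pos; rewrite in_itv in x1ab.
by move=> s sab; rewrite h1 ?h2// in_itv.
Qed.

End RealAnalysis.

(** * Asymptotics of the energies *)

(** What remains of the closed loop once the partial differential equations
    have been integrated out: the energies [H], [Hh] of plant and observer, the
    Lyapunov function [V] of their difference, the multiplier [rho] of the
    plant, and the velocity [c] at the controlled end. *)
Definition scalar_dynamics {R : realType} (psi : R -> R) (g p kappa c1 C Hs : R)
    (T : \bar R) (H Hh V rho c : R -> R) : Prop :=
  forall t, 0 < t /\ (t%:E < T)%E ->
  [/\ [/\ 0 <= H t, 0 <= Hh t & 0 <= V t],
      exists2 v, is_derive t 1 V v & v <= - kappa * V t,
      forall l, 0 < l ->
        `|Hh t - H t| <= l * (H t + C) + (1 + l^-1) * C * V t,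
      is_derive t 1 H (- (g * psi (Hh t - Hs) * c t ^+ 2)) &
      `|rho t| <= C * H t /\
      exists2 r, is_derive t 1 rho r &
        r <= (1 + p * psi (Hh t - Hs) ^+ 2) / 2 * c t ^+ 2 - c1 * H t].

Section ScalarDynamics.
Context {R : realType}.
Variables (psi : R -> R) (g p kappa c1 C Hs : R) (T : \bar R).
Variables (H Hh V rho c : R -> R).
Hypotheses (cpsi : continuous psi) (psis : forall s, s != 0 -> 0 < psi s * s).
Hypotheses (g0 : 0 < g) (p0 : 0 <= p) (kappa0 : 0 < kappa) (c10 : 0 < c1) (C0 : 0 < C).
Hypothesis Hs0 : 0 < Hs.
Hypothesis dyn : scalar_dynamics psi g p kappa c1 C Hs T H Hh V rho c.

Let alive t := 0 < t /\ (t%:E < T)%E.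

Let H_ge0 t : alive t -> 0 <= H t.
Proof. by move=> /dyn[[]]. Qed.

Let Hh_ge0 t : alive t -> 0 <= Hh t.
Proof. by move=> /dyn[[]]. Qed.

Let V_ge0 t : alive t -> 0 <= V t.
Proof. by move=> /dyn[[]]. Qed.

Let dV t : alive t -> exists2 v, is_derive t 1 V v & v <= - kappa * V t.
Proof. by move=> /dyn[]. Qed.

Let gap t l : alive t -> 0 < l ->
  `|Hh t - H t| <= l * (H t + C) + (1 + l^-1) * C * V t.
Proof. by move=> /dyn[_ _ h _ _] /h. Qed.

Let dH t : alive t -> is_derive t 1 H (- (g * psi (Hh t - Hs) * c t ^+ 2)).
Proof. by move=> /dyn[]. Qed.

Let rho_le t : alive t -> `|rho t| <= C * H t.
Proof. by move=> /dyn[_ _ _ _ []]. Qed.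

Let drho t : alive t -> exists2 r, is_derive t 1 rho r &
  r <= (1 + p * psi (Hh t - Hs) ^+ 2) / 2 * c t ^+ 2 - c1 * H t.
Proof. by move=> /dyn[_ _ _ _ []]. Qed.

Lemma psi_gt0 s : 0 < s -> 0 < psi s.
Proof. by move=> s0; have := psis (lt0r_neq0 s0); rewrite pmulr_lgt0. Qed.

Lemma psi_lt0 s : s < 0 -> psi s < 0.
Proof. by move=> s0; have := psis (ltr0_neq0 s0); rewrite nmulr_lgt0. Qed.

Lemma alive_le a s t : alive a -> alive t -> a <= s <= t -> alive s.
Proof.
move=> [a0 _] [_ tT] /andP[sa st]; split; first exact: lt_le_trans sa.
by apply: le_lt_trans tT; rewrite lee_fin.
Qed.

Lemma V_nonincreasing a b : alive a -> alive b -> a <= b -> V b <= V a.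
Proof.
move=> la lb ab.
have al s : a <= s <= b -> alive s by exact: alive_le.
have hV s : a <= s <= b -> is_derive s 1 V ('D_1 V s).
  by move=> /al/dV[v [dv _] _]; exact: DeriveDef.
apply: (nonincreasing_deriv ab hV) => s /andP[/ltW sa /ltW sb].
have ls : alive s by apply: al; rewrite sa.
have [v [_ ->] /le_trans] := dV ls; apply.
by rewrite mulNr oppr_le0 mulr_ge0 ?V_ge0// ltW.
Qed.

(** When [H] is large compared with the observation error, [Hh] exceeds [Hs]
    too, so that the control takes energy out of the plant. *)
Lemma energies_bounded a : alive a ->
  exists M, forall t, alive t -> a <= t -> H t <= M /\ Hh t <= M.
Proof.
move=> la.
pose M1 := 2 * Hs + C + 6 * C * V a.
have gap2 t : alive t -> a <= t ->
    `|Hh t - H t| <= (H t + C) / 2 + 3 * C * V a.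
  move=> lt at'; have := gap lt (_ : 0 < 2^-1); rewrite invr_gt0 ltr0n => /(_ isT).
  rewrite invrK; have := ler_wpM2l (ltW C0) (V_nonincreasing la lt at'); lra.
exists (2 * (Num.max (H a) M1 + C + 3 * C * V a)) => t lt at'.
have Ht : H t <= Num.max (H a) M1.
  apply: (@barrier _ H (fun s => - (g * psi (Hh s - Hs) * c s ^+ 2)) _ a t) => //.
  - by move=> s sat; apply: dH; exact: alive_le sat.
  - move=> s sat; have ls := alive_le la lt sat; have /andP[sa _] := sat.
    rewrite gt_max => /andP[_ M1H].
    have := gap2 s ls sa; rewrite ler_norml => /andP[h1 _].
    have sp : 0 < Hh s - Hs by move: M1H h1; rewrite /M1; lra.
    by rewrite oppr_le0 mulr_ge0 ?sqr_ge0// mulr_ge0 ?(ltW g0)// ltW// psi_gt0.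
  - by rewrite le_max lexx.
have := gap2 t lt at'; rewrite ler_norml => /andP[_ h2].
have Va := V_ge0 la; have CV : 0 <= C * V a by rewrite mulr_ge0// ltW.
have := H_ge0 lt; have := Hh_ge0 lt; have := C0.
move: (Num.max _ _) Ht h2 => M' Ht h2 *; split; lra.
Qed.

Hypothesis Ty : T = +oo%E.
Hypothesis H_neq0 : forall t, 0 < t -> 0 < H t.

Let alivey t : 0 < t -> alive t.
Proof. by move=> t0; split => //; rewrite Ty ltry. Qed.

Lemma V_vanishes d : 0 < d -> exists2 a, 0 < a & forall t, a <= t -> V t <= d.
Proof.
move=> d0; have [//|no] := pselect (exists2 a, 0 < a & forall t, a <= t -> V t <= d).
exfalso.
have big t : 1 <= t -> d < V t.
  move=> t1; have t0 : 0 < t by apply: lt_le_trans t1.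
  rewrite ltNge; apply/negP => Vt; apply: no; exists t => // s ts.
  apply: le_trans Vt; apply: V_nonincreasing => //; apply: alivey => //.
  exact: lt_le_trans ts.
have l1 t : 1 <= t -> alive t by move=> t1; apply: alivey; apply: lt_le_trans t1.
apply: (@no_linear_decrease _ V (fun s => 'D_1 V s) 1 (kappa * d) 0).
- by rewrite mulr_gt0.
- by move=> s /l1/dV[v [dv _] _]; exact: DeriveDef.
- move=> s s1; have [v [_ ->] /le_trans] := dV (l1 s s1); apply.
  by rewrite mulNr lerN2 ler_pM2l// ltW// big.
- by move=> s /l1; exact: V_ge0.
Qed.

(** The energies being bounded, a small weight [l] makes the first term of the
    gap estimate small, and the decay of [V] then disposes of the second. *)
Lemma gap_vanishes d : 0 < d ->
  exists2 a, 0 < a & forall t, a <= t -> `|Hh t - H t| <= d.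
Proof.
move=> d0; have [M HM] := energies_bounded (alivey ltr01).
pose N := `|M| + C; have N0 : 0 < N by rewrite ltr_wpDl.
pose l := d / (2 * N); have l0 : 0 < l by rewrite divr_gt0// mulr_gt0.
pose K := (1 + l^-1) * C.
have K0 : 0 < K by rewrite mulr_gt0// addr_gt0// invr_gt0.
have [a a0 ha] := V_vanishes (divr_gt0 d0 (mulr_gt0 (ltr0Sn R 1) K0)).
exists (Num.max a 1) => [|t]; first by rewrite lt_max a0.
rewrite ge_max => /andP[/ha Vt t1].
have lt : alive t by apply: alivey; apply: lt_le_trans t1.
apply: (le_trans (gap lt l0)); rewrite -/K.
have [Ht _] := HM t lt t1.
have e1 : l * (H t + C) <= d / 2.
  apply: (@le_trans _ _ (l * N)).
    by rewrite ler_pM2l// lerD2r (le_trans Ht)// ler_norm.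
  by rewrite /l le_eqVlt; apply/orP; left; apply/eqP; field; rewrite gt_eqF.
have e2 : K * V t <= d / 2.
  have Vt' : K * V t <= K * (d / (2 * K)) by rewrite ler_pM2l.
  apply: (le_trans Vt').
  by rewrite le_eqVlt; apply/orP; left; apply/eqP; field; rewrite gt_eqF.
lra.
Qed.

(** If the sign of the control stays fixed and its gain stays away from 0,
    the multiplier corrected by the energy decreases at least linearly. *)
Lemma no_stagnation (sg a b m d : R) : sg ^+ 2 = 1 -> 0 < a -> 0 < d ->
  m <= b ->
  (forall s, m <= s <= b -> 0 < sg * psi s) ->
  (forall t, a <= t -> m <= Hh t - Hs <= b) ->
  (forall t, a <= t -> d <= H t) -> False.
Proof.
move=> sg1 a0 d0 mb pos st Hd.
have la t : a <= t -> alive t by move=> t1; apply: alivey; apply: lt_le_trans t1.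
have [m1 [m2 [m10 m12]]] := continuous_signed_bounds mb cpsi pos.
have [M HM] := energies_bounded (la a (lexx a)).
pose K := (1 + p * m2 ^+ 2) / (2 * (g * m1)).
have gm0 : 0 < g * m1 by rewrite mulr_gt0.
have K0 : 0 < K.
  apply: divr_gt0; last by rewrite mulr_gt0.
  by rewrite ltr_wpDr// mulr_ge0// sqr_ge0.
apply: (@no_linear_decrease _ (fun t => rho t + K * (sg * H t))
  (fun t => 'D_1 rho t + K * (sg * - (g * psi (Hh t - Hs) * c t ^+ 2)))
  a (c1 * d) (- (C * M + K * M))).
- by rewrite mulr_gt0.
- move=> t ta; have lt := la t ta.
  have [r [dr _] _] := drho lt.
  have dr' : is_derive t 1 rho ('D_1 rho t) by exact: DeriveDef.
  exact: (is_deriveD dr' (is_deriveZ K (is_deriveZ sg (dH lt)))).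
- move=> t ta; have lt := la t ta.
  have [r [_ ->] rle] := drho lt.
  have /andP[h1 h2] := m12 _ (st t ta).
  move: rle h1 h2; set q := psi _; set w := c t ^+ 2 => rle h1 h2.
  have w0 : 0 <= w := sqr_ge0 _.
  have q2 : q ^+ 2 <= m2 ^+ 2.
    rewrite -[q ^+ 2]mul1r -sg1 -exprMn lerXn2r// nnegrE.
      by rewrite ltW// (lt_le_trans m10).
    by rewrite (le_trans (ltW m10))// (le_trans h1).
  have e1 : (1 + p * q ^+ 2) / 2 * w <= (1 + p * m2 ^+ 2) / 2 * w.
    by rewrite ler_wpM2r// ler_pM2r ?invr_gt0// lerD2l ler_wpM2l.
  have e2 : (1 + p * m2 ^+ 2) / 2 * w = K * (g * m1) * w.
    by congr (_ * w); rewrite /K; field; rewrite !gt_eqF.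
  have e3 : K * g * w * m1 <= K * g * w * (sg * q).
    by rewrite ler_wpM2l// mulr_ge0// mulr_ge0// ltW.
  have e4 : c1 * d <= c1 * H t by rewrite ler_pM2l// Hd.
  lra.
- move=> t ta; have lt := la t ta; have [HtM _] := HM t lt ta.
  have := rho_le lt; rewrite ler_norml => /andP[h1 _].
  have h2 : C * H t <= C * M by rewrite ler_pM2l.
  have sgH : - M <= sg * H t.
    have := sqrf_eq1 sg; rewrite sg1 eqxx => /esym/orP[]/eqP ->.
      by rewrite mul1r; have := H_ge0 lt; lra.
    by rewrite mulN1r; lra.
  have h3 : K * - M <= K * (sg * H t) by rewrite ler_pM2l.
  lra.
Qed.

(** After the gap has become smaller than [d / 2], the band of width [d] around
    [Hs] is invariant: [H] decreases above it and increases below it.  By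
    [no_stagnation], [H] stays neither above the band nor below it; below it,
    [H] is bounded away from 0 because it is increasing and positive. *)
Lemma energy_converges : H t @[t --> +oo] --> Hs.
Proof.
apply/cvgrPdist_le => d d0; have Hs_gt0 := Hs0.
have [a a0 ga] := gap_vanishes (divr_gt0 d0 (ltr0Sn R 1)).
have [M HM] := energies_bounded (alivey ltr01).
pose a1 := Num.max a 1.
have a10 : 0 < a1 by rewrite lt_max a0.
have ga1 t : a1 <= t -> `|Hh t - H t| <= d / 2.
  by rewrite ge_max => /andP[/ga].
have HM1 t : a1 <= t -> H t <= M /\ Hh t <= M.
  rewrite ge_max => /andP[_ t1]; apply: HM => //; apply: alivey.
  exact: lt_le_trans t1.
have al t : a1 <= t -> alive t.
  by move=> t1; apply: alivey; exact: lt_le_trans t1.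
have up : exists2 t, a1 <= t & H t <= Hs + d.
  apply: contrapT => no.
  have Hbig t : a1 <= t -> Hs + d <= H t.
    by move=> ta; rewrite ltW// ltNge; apply/negP => h; apply: no; exists t.
  apply: (@no_stagnation 1 a1 M (d / 2) (Hs + d)) => //.
  - by rewrite expr1n.
  - by rewrite addr_gt0.
  - have := Hbig _ (lexx a1); have [h _] := HM1 _ (lexx a1); lra.
  - by move=> s /andP[s0 _]; rewrite mul1r psi_gt0// (lt_le_trans _ s0)// divr_gt0.
  - move=> t ta; have := ga1 t ta; rewrite ler_norml => /andP[h1 _].
    by have := Hbig t ta; have [_ h2] := HM1 t ta; move=> *; apply/andP; split; lra.
have down : exists2 t, a1 <= t & Hs - d <= H t.
  apply: contrapT => no.
  have Hsmall t : a1 <= t -> H t < Hs - d.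
    by move=> ta; rewrite ltNge; apply/negP => h; apply: no; exists t.
  have neg t : a1 <= t -> - Hs <= Hh t - Hs <= - (d / 2).
    move=> ta; have := ga1 t ta; rewrite ler_norml => /andP[_ h1].
    have := Hsmall t ta; have := Hh_ge0 (al t ta) => h2 h3.
    by apply/andP; split; lra.
  (* The energy increases from its positive value at time a1. *)
  have Hpos t : a1 <= t -> H a1 <= H t.
    move=> ta; rewrite -lerN2.
    apply: (@nonincreasing_deriv _ (fun s => - H s)
      (fun s => - - (g * psi (Hh s - Hs) * c s ^+ 2)) a1 t) => //.
      move=> s /andP[sa _]; apply: is_deriveN; exact: dH (al s sa).
    move=> s /andP[/ltW sa _]; rewrite opprK.
    rewrite mulr_le0_ge0 ?sqr_ge0// mulr_ge0_le0 ?(ltW g0)// ltW// psi_lt0//.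
    have /andP[_ h] := neg s sa; apply: le_lt_trans h _.
    by rewrite oppr_lt0 divr_gt0.
  apply: (@no_stagnation (-1) a1 (- (d / 2)) (- Hs) (H a1)) => //.
  - by rewrite sqrrN expr1n.
  - exact: H_neq0.
  - by have /andP[h1 h2] := neg _ (lexx a1); exact: (le_trans h1 h2).
  - move=> s /andP[_ s0]; rewrite mulN1r oppr_gt0 psi_lt0//.
    by apply: le_lt_trans s0 _; rewrite oppr_lt0 divr_gt0.
have [t1 at1 Ht1] := up; have [t2 at2 Ht2] := down.
near=> t.
have t1t : t1 <= t by near: t; apply: nbhs_pinfty_ge; exact: num_real.
have t2t : t2 <= t by near: t; apply: nbhs_pinfty_ge; exact: num_real.
have Hup : H t <= Hs + d.
  apply: (@barrier _ H (fun s => - (g * psi (Hh s - Hs) * c s ^+ 2)) _ t1 t) => //.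
  - by move=> s /andP[st1 _]; apply/dH/al/(le_trans at1).
  - move=> s /andP[st1 _] Hbig; have sa := le_trans at1 st1.
    rewrite oppr_le0 mulr_ge0 ?sqr_ge0// mulr_ge0 ?(ltW g0)// ltW// psi_gt0//.
    by have := ga1 s sa; rewrite ler_norml => /andP[h1 _]; lra.
have Hdown : - H t <= - (Hs - d).
  apply: (@barrier _ (fun s => - H s)
    (fun s => - - (g * psi (Hh s - Hs) * c s ^+ 2)) _ t2 t) => //.
  - by move=> s /andP[st2 _]; apply: is_deriveN; apply/dH/al/(le_trans at2).
  - move=> s /andP[st2 _] Hbig; have sa := le_trans at2 st2; rewrite opprK.
    rewrite mulr_le0_ge0 ?sqr_ge0// mulr_ge0_le0 ?(ltW g0)// ltW// psi_lt0//.
    by have := ga1 s sa; rewrite ler_norml => /andP[_ h1]; lra.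
  - by rewrite lerN2.
by rewrite ler_norml; apply/andP; split; lra.
Unshelve. all: by end_near. Qed.

End ScalarDynamics.

(** * The closed loop *)

Section ClosedLoop.
Context {R : realType}.
Implicit Types (z zh : R -> R -> R) (T : \bar R) (t b c : R).

Lemma eta_condition (k beta eps : R) : 0 < beta ->
  (1 + 4 / pi ^+ 2) * beta < k -> eta beta k < eps ->
  beta < eps /\ beta * (1 + eps) * (4 / pi ^+ 2) < eps * (k - beta).
Proof.
move=> beta0 kb; rewrite /eta gt_max => /andP[-> he]; split => //.
have pi2 : 0 < pi ^+ 2 :> R by rewrite exprn_gt0// pi_gt0.
set P := pi ^+ 2 in pi2 kb he *.
have D0 : 0 < P * k - (P + 4) * beta.
  have : P * ((1 + 4 / P) * beta) < P * k by rewrite ltr_pM2l.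
  have -> : P * ((1 + 4 / P) * beta) = (P + 4) * beta by field; rewrite gt_eqF.
  by rewrite subr_gt0.
rewrite ltr_pdivrMr// in he.
rewrite -(ltr_pM2l pi2).
have -> : P * (beta * (1 + eps) * (4 / P)) = beta * (1 + eps) * 4.
  by field; rewrite gt_eqF.
lra.
Qed.

Section Reduction.
Variables (k beta : R) (psi : R -> R) (alpha gamma Hs eps : R).
Hypotheses (k0 : 0 < k) (beta0 : 0 < beta) (eps0 : 0 < eps).
Hypotheses (kb : (1 + 4 / pi ^+ 2) * beta < k).
Hypotheses (eta_eps : eta beta k < eps) (eps1 : eps < Num.min 1 k).
Hypothesis alpha_eps : eps * k / 2 * alpha ^+ 2 - k * alpha + eps / 2 <= 0.

Lemma scalar_reduction : exists kappa c1 C : R,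
  [/\ 0 < kappa, 0 < c1, 0 < C & forall T z zh, regular T z -> regular T zh ->
    (forall t, 0 <= t -> (t%:E < T)%E ->
       closed_loop_at k beta psi alpha gamma Hs z zh t) ->
    scalar_dynamics psi (k * gamma) (k * gamma ^+ 2) kappa c1 C Hs T
      (energy k beta z) (energy k beta zh)
      (lyapunov k eps (fun s x => wderiv (z s) x - wderiv (zh s) x)
        (fun s x => tderiv z s x - tderiv zh s x))
      (multiplier (fun s => wderiv (z s)) (tderiv z))
      (fun t => trace (tderiv z t) 1)].
Proof.
have [beta_eps etaP] := eta_condition beta0 kb eta_eps.
have [e1 ek] : eps < 1 /\ eps < k by move: eps1; rewrite lt_min => /andP.
have [kappa kappa0 decay] := lyapunov_decay k0 beta0 eps0 beta_eps etaP alpha_eps.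
have [Ca Ca0 gap] := energy_gap k0 beta0 eps0 e1 ek.
have [c1 [Cb [c10 Cb0 obs]]] := multiplier_observability k0 beta0 kb.
exists kappa, c1, (Ca + Cb); split; [by []|by []|exact: addr_gt0|].
move=> T z zh rz rzh cl t [t0 tT].
set V := lyapunov _ _ _ _; pose H := energy k beta z; pose Hh := energy k beta zh.
pose c (y : R -> R -> R) s := trace (tderiv y s) 1.
rewrite -/H -/Hh.
have waves s : 0 < s -> (s%:E < T)%E ->
    wave_at k z (fun s => wderiv (z s)) (tderiv z) (fun x => beta * sin (z s x)) s
      (control k beta psi gamma Hs z zh s) (c z s) /\
    wave_at k zh (fun s => wderiv (zh s)) (tderiv zh) (fun x => beta * sin (zh s x)) s
      (control k beta psi gamma Hs z zh s + alpha * (c z s - c zh s)) (c zh s).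
  move=> s0 sT; have [SG SGh [_ bz] [_ bzh]] := cl s (ltW s0) sT.
  have tr r : 0 <= r -> (r%:E < T)%E -> trace (z r) 0 = 0.
    by move=> r0 rT; have [_ _ []] := cl r r0 rT.
  have trh r : 0 <= r -> (r%:E < T)%E -> trace (zh r) 0 = 0.
    by move=> r0 rT; have [_ _ _ []] := cl r r0 rT.
  have := regular_wave rz s0 sT tr SG; have := regular_wave rzh s0 sT trh SGh.
  by rewrite bz bzh => w' w; split; [exact: w|exact: w'].
have HE s : 0 < s -> (s%:E < T)%E ->
    H s = mechanical k beta z (fun s => wderiv (z s)) (tderiv z) s /\
    Hh s = mechanical k beta zh (fun s => wderiv (zh s)) (tderiv zh) s.
  move=> s0 sT; have [w w'] := waves s s0 sT.
  have [? ? ? _] := wave_at_L2 w; have [? ? ? _] := wave_at_L2 w'.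
  by split; exact: energy_mechanical.
have [w w'] := waves t t0 tT; have [Ht Hht] := HE t t0 tT.
have [_ L2zx L2zt _] := wave_at_L2 w; have [_ L2zhx L2zht _] := wave_at_L2 w'.
have V0 : 0 <= V t.
  by apply: lyapunov_ge0 => //; exact: L2B.
have H0 : 0 <= H t by rewrite Ht; exact: mechanical_ge0.
have ctrl : control k beta psi gamma Hs z zh t =
    - gamma * psi (Hh t - Hs) * c z t by [].
have [ob1 [r dr rle]] := obs _ _ _ _ _ _ w.
split.
- by split => //; rewrite Hht; exact: mechanical_ge0.
- by apply: (decay _ _ _ _ _ _ _ _ _ _ _ w w'); rewrite opprD addNKr mulNr.
- move=> l l0; rewrite Ht Hht.
  apply: (le_trans (gap _ _ _ _ _ _ _ _ _ _ _ _ l0 w w')).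
  apply: lerD; first by rewrite ler_pM2l// lerD2l lerDl ltW.
  rewrite ler_wpM2r// ler_wpM2l ?lerDl ?(ltW Cb0)//.
  by rewrite addr_ge0// invr_ge0 ltW.
- have := mechanical_deriv w.
  rewrite (_ : k * _ * _ = - (k * gamma * psi (Hh t - Hs) * c z t ^+ 2)); last first.
    by rewrite ctrl; ring.
  apply: near_eq_is_derive; near=> s.
  have [s0 sT] : 0 < s /\ (s%:E < T)%E by near: s; exact: near_lifespan.
  by have [->] := HE s s0 sT.
- split.
    apply: (le_trans ob1); rewrite -Ht ler_wpM2r// lerDr ltW//.
  exists r => //; apply: (le_trans rle); rewrite -Ht lerD2r ctrl.
  by rewrite /c le_eqVlt; apply/orP; left; apply/eqP; ring.
Unshelve. all: by end_near. Qed.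

End Reduction.

(** Of the two solutions, the one that lives longer extends the other. *)
Lemma maximal_lifespan_unique (k beta : R) psi alpha gamma Hs
    (z0 z1 zh0 zh1 : R -> R) T z zh T' z' zh' :
  maximal_solution k beta psi alpha gamma Hs z0 z1 zh0 zh1 T z zh ->
  maximal_solution k beta psi alpha gamma Hs z0 z1 zh0 zh1 T' z' zh' ->
  agree_before (Order.min T T') z zh z' zh' -> T = T'.
Proof.
move=> [sol mx] [sol' mx'] ag.
have [TT'|/ltW T'T] := leP T T'.
  by rewrite (mx T' z' zh')//; move: ag; rewrite min_l.
rewrite -(mx' T z zh)// => t t0 tT; move: ag; rewrite min_r// => /(_ t t0 tT).
by move=> [e1 e2]; split; exact: ae_eq01_sym.
Qed.

End ClosedLoop.

Theorem theorem3 (R : realType) (k beta : R) (psi : R -> R)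
    (W0 : R -> R -> R -> set ((R -> R) * (R -> R))) :
  0 < k -> 0 < beta ->
  continuous psi -> psi 0 = 0 -> (forall s, s != 0 -> 0 < psi s * s) ->
  (1 + 4 / pi ^+ 2) * beta < k ->
  eta beta k < Num.min 1 k ->
  well_posed k beta psi W0 ->
  forall Hstar gamma : R, 0 < Hstar -> 0 < gamma ->
  forall eps : R, 0 < eps -> eta beta k < eps -> eps < Num.min 1 k ->
  forall alpha : R, 0 < alpha ->
  eps * k / 2 * alpha ^+ 2 - k * alpha + eps / 2 <= 0 ->
  forall z0 z1 zh0 zh1 : R -> R,
  W0 alpha gamma Hstar (z0, z1) -> W0 alpha gamma Hstar (zh0, zh1) ->
  forall (T : \bar R) (z zh : R -> R -> R),
  maximal_solution k beta psi alpha gamma Hstar z0 z1 zh0 zh1 T z zh ->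
  energy k beta z 0 <> 0 ->
  (forall t : R, 0 <= t -> (t%:E < T)%E -> energy k beta z t <> 0) ->
  T = +oo%E /\ energy k beta z t @[t --> +oo] --> Hstar.
Proof.
move=> k0 beta0 cpsi _ psis kb _ WP Hs gamma Hs0 gamma0 eps eps0 eta_eps eps1.
move=> alpha alpha0 alpha_eps z0 z1 zh0 zh1 Wz Wzh T z zh mxz _ Hneq0.
have [kappa [c1 [C [kappa0 c10 C0 red]]]] :=
  scalar_reduction psi gamma Hs k0 beta0 eps0 kb eta_eps eps1 alpha_eps.
have kg0 : 0 < k * gamma by rewrite mulr_gt0.
have p0 : 0 <= k * gamma ^+ 2 by rewrite mulr_ge0 ?sqr_ge0// ltW.
(* The solution provided by well-posedness blows up if it is not global, but
   the energies stay bounded. *)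
have Ty : T = +oo%E.
  have [_ _ /(_ z0 z1 zh0 zh1 Wz Wzh)] := WP alpha gamma Hs alpha0 gamma0 Hs0.
  move=> [T' [z' [zh' [mx' uniq blowup _]]]].
  rewrite (maximal_lifespan_unique mxz mx'); last first.
    have [sol _] := mxz; have ag := uniq _ _ _ sol.
    by rewrite minC => t t0 tT; have [e1 e2] := ag t t0 tT; split; exact: ae_eq01_sym.
  have [[T'0 [rz' rzh'] _ _ cl'] _] := mx'.
  have red' := red T' z' zh' rz' rzh' cl'.
  case: T' T'0 blowup red' {mx' uniq rz' rzh' cl'} => [r| |//] //.
  rewrite lte_fin => r0 /(_ r erefl) blowup red'.
  exfalso.
  have r2 : 0 < r / 2 by rewrite divr_gt0.
  have la : 0 < r / 2 /\ ((r / 2)%:E < r%:E)%E by split => //; rewrite lte_fin; lra.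
  have [M HM] := energies_bounded psis kg0 kappa0 C0 red' la.
  have : \forall t \near r^'-, False; last by move/filter_ex => -[].
  near=> t.
  have tr : t < r by near: t; exact: nbhs_left_lt.
  have rt : r / 2 < t by near: t; apply: nbhs_left_gt; lra.
  have big : 2 * M + 1 <= energy k beta z' t + energy k beta zh' t.
    by near: t; move/cvgryPge : blowup; apply.
  have lt : 0 < t /\ (t%:E < r%:E)%E by split; [lra|rewrite lte_fin].
  have [] := HM t lt (ltW rt); lra.
split => //.
have [[T0 [rz rzh] _ _ cl] _] := mxz.
have red' := red T z zh rz rzh cl.
have Hpos t : 0 < t -> 0 < energy k beta z t.
  move=> t0; have tT : (t%:E < T)%E by rewrite Ty ltry.
  have [[h _ _] _ _ _ _] := red' t (conj t0 tT).
  by rewrite lt_neqAle h andbT eq_sym; apply/eqP; exact: Hneq0 (ltW t0) tT.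
exact: (energy_converges cpsi psis kg0 p0 kappa0 c10 C0 Hs0 red' Ty Hpos).
Unshelve. all: by end_near. Qed.
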